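(* Let $F$ satisfy the standing assumptions below, let $\lambda>0$, and run the general conversion scheme below with an online learner $\mathcal{A}$ which, for every $t\in[T]$ and every comparator $\mathbf{u}\in\mathbb{R}^d$ (deterministic or depending on the run), satisfies $$\mathbb{E}[\mathrm{Regret}^\beta_t(\mathbf{u})]\le\frac{2\|\mathbf{u}\|(G+\sigma)}{\beta\sqrt{1-\beta}}+\frac{\mu}{2}\|\mathbf{u}\|^2.$$ Let $\varepsilon>0$ with $\varepsilon\le\frac72(G+\sigma)$ and $T\ge49(G+\sigma)^2\varepsilon^{-2}$. Choose $\beta=\beta_\star=1-\left(\frac{\varepsilon}{7(G+\sigma)}\right)^2$, $D_\star=\frac14\lambda^{-1/2}\varepsilon^{1/2}\left(1+\frac{49(G+\sigma)^2}{\varepsilon^2}\sqrt{C_{\mathbf{x}}}\right)^{-1}$, and $\mu=\mu_\star=2\lambda^{1/2}\varepsilon^{1/2}\left(1+\frac{49(G+\sigma)^2}{\varepsilon^2}\sqrt{C_{\mathbf{x}}}\right)$. Then $$\mathbb{E}_\tau\|\nabla F(\overline{\mathbf{y}}_\tau)\|_\lambda\le3\varepsilon+\frac{1}{D_\star T}\,\mathbb{E}\sum_{t=1}^T\big(F(\mathbf{x}_t)-F(\mathbf{w}_t)\big).$$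
   Context: Norms are Euclidean. Standing assumptions: $F:\mathbb{R}^d\to\mathbb{R}$ is differentiable; for all $\mathbf{x},\mathbf{w}$, $F(\mathbf{x})-F(\mathbf{w})=\int_0^1\langle\nabla F(\mathbf{w}+t(\mathbf{x}-\mathbf{w})),\mathbf{x}-\mathbf{w}\rangle\,dt$; $\|\nabla F(\mathbf{x})\|\le G$ for all $\mathbf{x}$. A stochastic gradient oracle, called at $\mathbf{x}$, independently returns $\mathbf{g}$ with $\mathbb{E}[\mathbf{g}]=\nabla F(\mathbf{x})$ and $\mathbb{E}\|\mathbf{g}-\nabla F(\mathbf{x})\|^2\le\sigma^2$. For $\lambda>0$: $\|\nabla F(\mathbf{x})\|_\lambda := \inf\{\|\mathbb{E}_{\mathbf{w}\sim p}\nabla F(\mathbf{w})\| + \lambda\,\mathbb{E}_{\mathbf{w}\sim p}\|\mathbf{w}-\mathbf{x}\|^2\}$, the infimum over probability distributions $p$ on $\mathbb{R}^d$ with mean $\mathbf{x}$. General conversion scheme: input $\mathbf{x}_0=\mathbf{w}_0\in\mathbb{R}^d$, $T$, $\mu\ge0$, online learner $\mathcal{A}$ (outputting $\Delta_t\in\mathbb{R}^d$ at round $t$ based on $\ell_1,\dots,\ell_{t-1}$). For $t=1,\dots,T$: receive $\Delta_t$; choose $\mathbf{x}_t$ arbitrarily (may depend on everything so far including $\Delta_t$, not on $s_t,\mathbf{g}_t$ or later randomness); $\mathbf{w}_t=\mathbf{x}_t+\Delta_t$; $\mathbf{y}_t=\mathbf{x}_t+s_t\Delta_t$, $s_t\sim\mathrm{Unif}[0,1]$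 i.i.d.; $\mathbf{g}_t$ = oracle output at $\mathbf{y}_t$; send $\ell_t(\mathbf{v})=\langle\mathbf{g}_t,\mathbf{v}\rangle+\frac\mu2\|\mathbf{v}\|^2$ to $\mathcal{A}$. Discounted regret: $\mathrm{Regret}^\beta_t(\mathbf{u}) := \sum_{s=1}^t\beta^{t-s}(\ell_s(\Delta_s)-\ell_s(\mathbf{u}))$. EMA: $\overline{\mathbf{y}}_t := \frac{1-\beta}{1-\beta^t}\sum_{s=1}^t\beta^{t-s}\mathbf{y}_s$. Random index $\tau$, independent of the algorithm: $\Pr(\tau=t)=\frac{1-\beta^t}{T}$ for $t\le T-1$, $\Pr(\tau=T)=\frac{1-\beta^T}{(1-\beta)T}$; $\mathbb{E}_\tau$ is expectation over $\tau$ and all randomness of the algorithm. $C_{\mathbf{x}}$ is the smallest $C\ge0$ with $\mathbb{E}\sum_{t=1}^T\|\mathbf{x}_t-\mathbf{x}_{t-1}\|^2\le C\,\mathbb{E}\sum_{t=1}^T\|\Delta_t\|^2$. *)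

(* Defs.v *)
From HB Require Import structures.
From mathcomp Require Import all_boot all_order all_algebra.
From mathcomp Require Import all_classical all_reals all_analysis.
Set Implicit Arguments. Unset Strict Implicit. Unset Printing Implicit Defensive.
Import Order.TTheory GRing.Theory Num.Theory.
Import numFieldNormedType.Exports.
Local Open Scope classical_set_scope.
Local Open Scope ring_scope.

Section Defs.
Context {R : realType} {d : nat}.
Local Notation V := 'rV[R]_d.

Definition vdot (u v : V) : R := \sum_(i < d) u ord0 i * v ord0 i.
Definition vnorm (u : V) : R := Num.sqrt (vdot u u).

Definition grad (F : V -> R) (x : V) : V :=
  \row_(i < d) ('d F x) (delta_mx ord0 i : V).

Definition vEx {dO} {O : measurableType dO} (Q : probability O R) (W : O -> V) : V :=
  \row_(i < d) fine (\int[Q]_o (W o ord0 i)%:E)%E.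

(** ||grad F(x)||_lambda : infimum, over all probability distributions p on R^d
    with mean x (realised as laws of integrable random vectors W on arbitrary
    probability spaces), of ||E_p grad F(w)|| + lambda E_p ||w - x||^2. *)
Definition lam_norm (F : V -> R) (lam : R) (x : V) : \bar R :=
  ereal_inf [set r : \bar R | exists (dO : measure_display) (O : measurableType dO)
      (Q : probability O R) (W : O -> V),
      [/\ (forall i, Q.-integrable setT (fun o => (W o ord0 i)%:E)),
          (forall i, Q.-integrable setT (fun o => (grad F (W o) ord0 i)%:E)),
          vEx Q W = x &
          r = ((vnorm (vEx Q (fun o => grad F (W o))))%:E
               + lam%:E * \int[Q]_o ((vnorm (W o - x)) ^+ 2)%:E)%E]].

Definition Gmeas {T : Type} (Gs : set (set T)) (f : T -> R) : Prop :=
  forall B : set R, measurable B -> Gs (f @^-1` B).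
Definition Gmeas_v {T : Type} (Gs : set (set T)) (X : T -> V) : Prop :=
  forall i, Gmeas Gs (fun o => X o ord0 i).

Definition loss (mu : R) (g v : V) : R := vdot g v + mu / 2 * vnorm v ^+ 2.

Definition regret {T : Type} (beta mu : R) (g Delta : nat -> T -> V) (t : nat)
    (u : V) (o : T) : R :=
  \sum_(1 <= k < t.+1) beta ^+ (t - k) *
     (loss mu (g k o) (Delta k o) - loss mu (g k o) u).

Definition ema {T : Type} (beta : R) (y : nat -> T -> V) (t : nat) (o : T) : V :=
  ((1 - beta) / (1 - beta ^+ t)) *: \sum_(1 <= k < t.+1) beta ^+ (t - k) *: y k o.

Definition tau_prob (beta : R) (T t : nat) : R :=
  if (t < T)%N then (1 - beta ^+ t) / T%:R
  else (1 - beta ^+ T) / ((1 - beta) * T%:R).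

Definition beta_star (G sigma eps : R) : R := 1 - (eps / (7 * (G + sigma))) ^+ 2.
Definition kappa_star (G sigma eps C : R) : R :=
  1 + 49 * (G + sigma) ^+ 2 / eps ^+ 2 * Num.sqrt C.
Definition D_star (lam G sigma eps C : R) : R :=
  4^-1 * (Num.sqrt lam)^-1 * Num.sqrt eps * (kappa_star G sigma eps C)^-1.
Definition mu_star (lam G sigma eps C : R) : R :=
  2 * Num.sqrt lam * Num.sqrt eps * kappa_star G sigma eps C.

End Defs.

(* Main.v *)
(** The comparator [u_t = - D S_t / |S_t|], with [S_t] the discounted sum of the
    gradients at [y_1 .. y_t], turns the discounted regret of round [t] into
    [D |S_t|].  The weights [1 - beta] (for [t < T]) and [1] (for [t = T]) undo
    the discounting, and they are, up to the factor [(1 - beta^t) / (1 - beta)],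
    the probabilities of [tau].  The undiscounted losses have expectation
    [F(w_t) - F(x_t) + mu/2 |Delta_t|^2]: the oracle is unbiased given the past
    and [s_t], and averaging over [s_t] produces the line integral of the
    gradient.  The discounted noise is a martingale sum with second moment at
    most [sigma^2 / (1 - beta)].

    The average of the [y_s] with the weights of the EMA is an admissible
    distribution in [lam_norm], so [|grad F|_lam] at the EMA is at most
    [(1 - beta) / (1 - beta^t) (|S_t| + lam V_t)] with [V_t] the discounted sum
    of [|y_s - x_t|^2].  [V_t] satisfies a contraction of ratio
    [(1 + beta) / 2], whence the weighted sum of the [V_t] is at most
    [2 sum |Delta|^2 + 4 / (1 - beta)^2 sum |x_t - x_{t-1}|^2]; after
    multiplication by [lam] this is absorbed by the regularisation term
    [mu/2 |Delta_t|^2]. *)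
Require Import Defs.
From HB Require Import structures.
From mathcomp Require Import all_boot all_order all_algebra.
From mathcomp Require Import all_classical all_reals all_analysis.
From mathcomp Require Import measurable_realfun.
From mathcomp Require Import ring lra.
Import Order.TTheory GRing.Theory Num.Theory.
Import numFieldNormedType.Exports.
Local Open Scope classical_set_scope.
Local Open Scope ring_scope.

Set Implicit Arguments.
Unset Strict Implicit.
Unset Printing Implicit Defensive.

(** * Measurability of continuous functions and gradients along a random vector *)

Lemma measurable_floor_eq (R : realType) (dT : measure_display)
    (T : measurableType dT) (f : T -> R) (k : int) :
  measurable_fun setT f -> measurable [set o | Num.floor (f o) = k].
Proof.
move=> mf.
have -> : [set o | Num.floor (f o) = k] =
    setT `&` f @^-1` [set` `[k%:~R, (k + 1)%:~R[].
  apply/seteqP; split => o /=; rewrite in_itv/=.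
    by move=> <-; split => //; rewrite floor_le floorD1_gt.
  by move=> [_ h]; apply: floor_def.
exact: mf.
Qed.

(** Random vectors are measurable coordinate by coordinate, so [X] is rounded down to the grid of
    mesh [1 / (m + 1)]. The rounded vector takes countably many values, each on a measurable set,
    and by continuity [f] of it converges pointwise to [f \o X]. *)
Lemma measurable_continuous_comp (R : realType) (n : nat)
    (dT : measure_display) (T : measurableType dT)
    (f : 'rV[R]_n -> R) (X : T -> 'rV[R]_n) :
  continuous f -> (forall i, measurable_fun setT (fun o => X o ord0 i)) ->
  measurable_fun setT (f \o X).
Proof.
move=> cf mX.
pose K (m : nat) (o : T) : 'rV[int]_n :=
  \row_i Num.floor (m.+1%:R * X o ord0 i).
pose Y (m : nat) (k : 'rV[int]_n) : 'rV[R]_n :=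
  \row_i ((k ord0 i)%:~R / m.+1%:R).
apply: (@measurable_fun_cvg _ _ _ _ (fun m => f \o Y m \o K m)).
- move=> m _ B mB; rewrite setTI.
  have -> : (f \o Y m \o K m) @^-1` B =
      \bigcup_(k in [set k | B (f (Y m k))]) (K m @^-1` [set k]).
    by apply/seteqP; split => [ o Bo|o [k Bk ok]]; [exists (K m o)|rewrite /= ok].
  rewrite bigcup_mkcond.
  apply: countable_bigcupT_measurable; first exact: countableP.
  move=> k; case: ifP => // _.
  have -> : K m @^-1` [set k] =
      \bigcap_(i in [set: 'I_n])
         [set o | Num.floor (m.+1%:R * X o ord0 i) = k ord0 i].
    apply/seteqP; split => [ o ok i _|o h]; first by rewrite -ok/= mxE.
    by apply/rowP => i; rewrite mxE; exact: h.
  apply: fin_bigcap_measurable; first exact: finite_finset.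
  by move=> i _; apply/measurable_floor_eq/measurable_funM.
- move=> o _.
  apply: (@cvg_comp _ _ _ (fun m => Y m (K m o)) f \oo (nbhs (X o))); last exact: cf.
  apply/cvg_ballP => e e0; near=> m; split => // i j.
  rewrite (ord1 i) !mxE /ball/= distrC.
  set a := X o ord0 j.
  have m0 : 0 < m.+1%:R :> R by [].
  have -> : (Num.floor (m.+1%:R * a))%:~R / m.+1%:R - a =
      - ((m.+1%:R * a - (Num.floor (m.+1%:R * a))%:~R) / m.+1%:R) :> R.
    by rewrite mulrBl mulrAC divff ?pnatr_eq0// mul1r opprB.
  rewrite normrN ger0_norm; last first.
    by rewrite divr_ge0// subr_ge0 floor_le.
  rewrite (@lt_le_trans _ _ (1 / m.+1%:R))//.
    by rewrite ltr_pM2r ?invr_gt0// ltrBlDl -intrD1 floorD1_gt.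
  rewrite mul1r ltW//; near: m; exact: near_infty_natSinv_lt (PosNum e0).
Unshelve. all: by end_near. Qed.

(** A partial derivative is the pointwise limit of difference quotients with steps [1 / (m + 1)].
    Each quotient is measurable because [f] is continuous; the gradient itself may be
    discontinuous. *)
Lemma measurable_grad_comp (R : realType) (n : nat)
    (dT : measure_display) (T : measurableType dT)
    (f : 'rV[R]_n -> R) (X : T -> 'rV[R]_n) (i : 'I_n) :
  (forall z, differentiable f z) ->
  (forall i, measurable_fun setT (fun o => X o ord0 i)) ->
  measurable_fun setT (fun o => grad f (X o) ord0 i).
Proof.
move=> df mX.
have cf : continuous f by move=> z; exact: differentiable_continuous.
pose e : 'rV[R]_n := delta_mx ord0 i.
apply: (@measurable_fun_cvg _ _ _ _
  (fun m o => m.+1%:R * (f (m.+1%:R^-1 *: e + X o) - f (X o)))).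
- move=> m; apply: measurable_funM => //; apply: measurable_funB.
    apply: (@measurable_continuous_comp _ _ _ _ f (fun o => m.+1%:R^-1 *: e + X o)) => //.
    move=> j; under eq_fun do rewrite !mxE.
    exact: measurable_funD.
  exact: measurable_continuous_comp.
- move=> o _; rewrite mxE.
  rewrite -deriveE//.
  have /cvg_ex[/= l hl] : derivable f (X o) e by exact: diff_derivable.
  have -> : 'D_e f (X o) = l by exact: cvg_lim hl.
  have u0 : m.+1%:R^-1 @[m --> \oo] --> (0 : R)^'.
    move=> A /= [e' /= e'0 hA]; change (\forall m \near \oo, A m.+1%:R^-1); near=> m; apply: hA => /=; last first.
      by rewrite invr_eq0 pnatr_eq0.
    rewrite sub0r normrN ger0_norm ?invr_ge0//.
    by near: m; exact: near_infty_natSinv_lt (PosNum e'0).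
  have := cvg_comp _ _ u0 hl.
  apply: cvg_trans; apply: near_eq_cvg; apply: nearW => m /=.
  by rewrite invrK.
Unshelve. all: by end_near. Qed.

(** * Pulling a known factor out of a conditionally centred integral *)

Section sub_sigma_algebra.
Context {R : realType} {dO : measure_display} {Omega : measurableType dO}.
Variables (P : probability Omega R) (Hs : set (set Omega)).
Hypotheses (sH : sigma_algebra setT Hs) (subH : Hs `<=` measurable).

Local Notation OmegaH := (g_sigma_algebraType Hs).

Lemma measurable_sub_sigma_algebraE (A : set OmegaH) :
  measurable A = Hs A :> Prop.
Proof. by rewrite {1}/measurable/= sigma_algebra_id. Qed.

(** Turns the set-theoretic [Gmeas] into measurability on the type [OmegaH], where the closure
    properties of measurable functions apply. *)
Lemma GmeasE (f : Omega -> R) :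
  Gmeas Hs f <-> measurable_fun [set: OmegaH] (f : OmegaH -> R).
Proof.
split=> [mf _ B mB|mf B mB].
  by rewrite measurable_sub_sigma_algebraE setTI; exact: mf.
by rewrite -measurable_sub_sigma_algebraE -[X in measurable X]setTI; exact: mf.
Qed.

Lemma measurable_sub_id : measurable_fun [set: Omega] (id : Omega -> OmegaH).
Proof.
by move=> _ A; rewrite measurable_sub_sigma_algebraE setTI => /subH.
Qed.

Lemma Gmeas_measurable (f : Omega -> R) : Gmeas Hs f -> measurable_fun setT f.
Proof. by move=> mf _ B mB; rewrite setTI; exact/subH/mf. Qed.

Section pull_out.
Variable xi : Omega -> R.
Hypothesis ixi : P.-integrable setT (EFin \o xi).
Hypothesis xi0 : forall A, Hs A -> (\int[P]_(o in A) (xi o)%:E = 0)%E.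

Import HBNNSimple.

(** A simple function is a finite combination of indicators of its level sets; these lie in [Hs],
    where [xi] integrates to 0. *)
Let integral_nnsfun_mul0 (h : {nnsfun OmegaH >-> R}) :
  P.-integrable setT (fun o : Omega => (h o * xi o)%:E) /\
  (\int[P]_o (h o * xi o)%:E = 0)%E.
Proof.
pose A (r : R) : set Omega := h @^-1` [set r].
have HA r : Hs (A r).
  by rewrite -measurable_sub_sigma_algebraE; exact: measurable_sfunP.
have mA r : measurable (A r) by exact: subH.
pose f r (o : Omega) : \bar R := (r%:E * ((EFin \o xi) \_ (A r)) o)%E.
have intf r : P.-integrable setT (f r).
  apply: integrableZl => //; apply/(integrable_mkcond _ (mA r)).
  exact: (integrableS measurableT (mA r) (@subsetT _ _) ixi).
have hE o : (h o * xi o)%:E = (\sum_(r <- finmap.enum_fset (fset_set (range h))) f r o)%E.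
  rewrite {1}fimfunE fsbig_finite//= mulr_suml -sumEFin.
  apply: eq_bigr => r _; rewrite /f /patch /A indicE.
  by case: ifP => _; rewrite /= ?mulr1 ?mulr0 ?mul0r ?mule0// EFinM.
split.
  apply: (eq_integrable _ (fun o => \sum_(r <- finmap.enum_fset (fset_set (range h))) f r o)%E) => //.
  exact: integrable_sum.
under eq_integral do rewrite hE.
rewrite integral_sum//; apply: big1 => r _.
rewrite integralZl//; last first.
  apply/(integrable_mkcond _ (mA r)).
  exact: (integrableS measurableT (mA r) (@subsetT _ _) ixi).
by rewrite -integral_mkcond /= xi0 ?mule0.
Qed.

(** Simple functions increase to [Z], and [|Z xi|] dominates the products, so dominated convergence
    passes to the limit. *)
Let integral_mul0_ge0 (Z : Omega -> R) : (forall o, 0 <= Z o) -> Gmeas Hs Z ->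
  P.-integrable setT (fun o => (Z o * xi o)%:E) ->
  (\int[P]_o (Z o * xi o)%:E = 0)%E.
Proof.
move=> Z0 /GmeasE mZ iZ.
have mEZ : measurable_fun [set: OmegaH] (EFin \o Z) by exact/measurable_EFinP.
pose h := nnsfun_approx measurableT mEZ.
have hZ o : h n o @[n --> \oo] --> Z o.
  have /= /fine_cvgP[_] := @cvg_nnsfun_approx _ _ _ _ measurableT _ mEZ
     (fun o _ => Z0 o) o I.
  exact.
have hle n o : h n o <= Z o.
  have nd : nondecreasing_seq (h ^~ o).
    by move=> a b ab; exact/lefP/nd_nnsfun_approx.
  have := nondecreasing_cvgn_le nd (cvgP _ (hZ o)) n.
  by rewrite (cvg_lim _ (hZ o)).
have [||_ _] := @dominated_convergence _ _ _ P _ measurableT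
  (fun n o => (h n o * xi o)%:E) (fun o => (Z o * xi o)%:E)
  (fun o => `|(Z o * xi o)%:E|%E)
  (fun n => measurable_int P (integral_nnsfun_mul0 (h n)).1) (measurable_int P iZ) _
  (integrable_abse iZ).
- apply: aeW => o _; apply: cvg_EFin; first exact: nearW.
  by apply: cvgMr_tmp; exact: hZ.
- apply: aeW => o n _; rewrite lee_fin !normrM ler_wpM2r//.
  by rewrite !ger0_norm.
have -> : [sequence (\int[P]_o (h n o * xi o)%:E)%E]_n = cst 0%E.
  by apply/funext => n /=; exact: (integral_nnsfun_mul0 (h n)).2.
by move=> H; apply/esym; apply: cvg_unique H => //; exact: cvg_cst.
Qed.

(** The hypothesis on [xi] says that its conditional expectation given [Hs] is 0. The positive and
    negative parts of [Z] are at most [|Z|], so their products with [xi] inherit integrability and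
    the nonnegative case applies to each. *)
Lemma integral_pull_out0 (Z : Omega -> R) : Gmeas Hs Z ->
  P.-integrable setT (fun o => (Z o * xi o)%:E) ->
  (\int[P]_o (Z o * xi o)%:E = 0)%E.
Proof.
move=> GZ iZ; have mZ := Gmeas_measurable GZ.
have mxi : measurable_fun setT xi by apply/measurable_EFinP; exact: measurable_int ixi.
have part (Y : Omega -> R) : (forall o, 0 <= Y o) -> (forall o, Y o <= `|Z o|) ->
    measurable_fun [set: OmegaH] (Y : OmegaH -> R) ->
    P.-integrable setT (fun o => (Y o * xi o)%:E) /\
    (\int[P]_o (Y o * xi o)%:E = 0)%E.
  move=> Y0 YZ /GmeasE GY; have mY := Gmeas_measurable GY.
  have iY : P.-integrable setT (fun o => (Y o * xi o)%:E).
    apply: le_integrable iZ => //.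
      exact/measurable_EFinP/measurable_funM.
    by move=> o _; rewrite lee_fin !normrM ler_wpM2r// (ger0_norm (Y0 o)).
  by split => //; exact: integral_mul0_ge0.
move/GmeasE : (GZ) => mZH.
have [ip p0] : P.-integrable setT (fun o => (Num.max (Z o) 0 * xi o)%:E) /\
    (\int[P]_o (Num.max (Z o) 0 * xi o)%:E = 0)%E.
  apply: part => [ o|o|]; rewrite ?le_max ?lexx ?orbT// ?ge_max ?normr_ge0 ?ler_norm//.
  exact: measurable_maxr.
have [im m0] : P.-integrable setT (fun o => (Num.max (- Z o) 0 * xi o)%:E) /\
    (\int[P]_o (Num.max (- Z o) 0 * xi o)%:E = 0)%E.
  apply: part => [ o|o|]; rewrite ?le_max ?lexx ?orbT// ?ge_max ?normr_ge0.
    by rewrite -normrN ler_norm.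
  by apply: measurable_maxr => //; exact: measurableT_comp.
transitivity (\int[P]_o ((Num.max (Z o) 0 * xi o)%:E - (Num.max (- Z o) 0 * xi o)%:E))%E.
  apply: eq_integral => o _; rewrite -EFinB -mulrBl; congr (_ * _)%:E.
  by rewrite /Num.max; case: ltP => ?; case: ltP => ?; lra.
by rewrite integralB// p0 m0 sube0.
Qed.

End pull_out.
End sub_sigma_algebra.

(** * Averaging over a uniform variable independent of the past *)

Section independent_uniform.
Context {R : realType} {dO : measure_display} {Omega : measurableType dO}.
Variables (P : probability Omega R) (Gs : set (set Omega)).
Hypotheses (sG : sigma_algebra setT Gs) (subG : Gs `<=` measurable).

Local Notation OmegaG := (g_sigma_algebraType Gs).

(** The complement of the unit interval is [Q]-null, and inside the interval [Q] agrees with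
    Lebesgue measure. *)
Lemma integral_uniform_law (Q : probability (measurableTypeR R) R) (f : R -> R) :
  (forall B, measurable B -> Q B = lebesgue_measure (B `&` `[0, 1])) ->
  measurable_fun setT f ->
  (\int[Q]_r (f r)%:E = \int[lebesgue_measure]_(r in `[0%R, 1%R]) (f r)%:E)%E.
Proof.
move=> QE mf; have mI : measurable (`[0, 1]%classic : set R) by [].
transitivity (\int[Q]_(r in `[0%R, 1%R]) (f r)%:E)%E.
  rewrite [RHS]integral_mkcond; apply: ae_eq_integral => //.
  - exact/measurable_EFinP.
  - by apply/(measurable_restrictT _ mI)/measurable_funTS/measurable_EFinP.
  - exists (~` `[0, 1]); split.
    + exact: measurableC.
    + by apply: etrans (QE _ (measurableC mI)) _; rewrite setICl measure0.
    + move=> r /=; apply: contra_not => Ir _ /=; rewrite patchE ifT//.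
      by rewrite inE.
by apply: eq_measure_integral => B mB sB; apply: etrans (QE _ mB) _; rewrite setIidl.
Qed.

Variable s : Omega -> R.
Hypothesis ms : measurable_fun setT s.
Hypothesis indep : forall A B, Gs A -> measurable B ->
  P (A `&` s @^-1` B) = (P A * lebesgue_measure (B `&` `[0%R, 1%R]))%E.

(** The identity, seen as a map into [OmegaG], is a random variable carrying exactly the information
    in [Gs]. Independence makes its joint law with [s] a product measure, and Fubini gives both
    integrability and the iterated integral. *)
Lemma integral_independent_uniform (h : OmegaG * measurableTypeR R -> R) :
  measurable_fun setT h ->
  P.-integrable setT (fun o : Omega => (h (o, s o))%:E) ->
  P.-integrable setT (fun o : Omega =>
    \int[lebesgue_measure]_(r in `[0%R, 1%R]) (h (o, r))%:E)%E /\
  (\int[P]_o (h (o, s o))%:E =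
   \int[P]_o \int[lebesgue_measure]_(r in `[0%R, 1%R]) (h (o, r))%:E)%E.
Proof.
move=> mh ih.
have mid : measurable_fun [set: Omega] (id : Omega -> OmegaG).
  exact: measurable_sub_id.
pose idm : {mfun Omega >-> OmegaG} := HB.pack (id : Omega -> OmegaG)
  (isMeasurableFun.Build _ _ _ _ _ mid).
have msR : measurable_fun setT (s : Omega -> measurableTypeR R).
  by move=> mT B mB; exact: ms.
pose sm : {mfun Omega >-> measurableTypeR R} := HB.pack s (isMeasurableFun.Build _ _ _ _ _ msR).
pose m1 := distribution P idm; pose m2 := distribution P sm.
pose phi (o : Omega) : OmegaG * measurableTypeR R := (o, s o).
have mphi : measurable_fun [set: Omega] phi by exact: measurable_fun_pair.
have m2E B : measurable B -> m2 B = lebesgue_measure (B `&` `[0, 1]).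
  move=> mB; rewrite /m2 /distribution /pushforward/= -[X in P X]setTI.
  rewrite indep// ?probability_setT ?mul1e//.
  by case: sG => G0 GC _; rewrite -(setD0 setT); exact: GC.
(* A product measure is determined by its values on rectangles, and those are what [indep]
   provides. *)
have nuE X : measurable X -> (m1 \x m2)%E X = pushforward P phi X.
  apply: product_measure_unique => A B mA mB.
  transitivity (P A * lebesgue_measure (B `&` `[0%R, 1%R]))%E.
    by rewrite -indep// -(measurable_sub_sigma_algebraE sG).
  by congr (_ * _)%E; apply/esym; exact: m2E.
have mEh : measurable_fun setT (EFin \o h) by exact/measurable_EFinP.
have ihnu : (m1 \x m2)%E.-integrable setT (EFin \o h).
  have /integrableP[_ hoo] := integrable_pushforward mphi mEh ih measurableT.
  apply/integrableP; split => //; apply: le_lt_trans hoo.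
  by rewrite le_eqVlt; apply/orP; left; apply/eqP/eq_measure_integral => B mB _;
     exact: nuE.
have hE : (\int[P]_o (h (o, s o))%:E = \int[m1 \x m2]_z (h z)%:E)%E.
  rewrite -[LHS](integral_pushforward mphi mEh ih measurableT).
  by apply: eq_measure_integral => B mB _; apply/esym; exact: nuE.
have mF : measurable_fun setT (fubini_F m2 (EFin \o h)) := measurable_fubini_F ihnu.
have iF : m1.-integrable setT (fubini_F m2 (EFin \o h)) := integrable_fubini_F ihnu.
have iFid : P.-integrable setT (fubini_F m2 (EFin \o h) \o (id : Omega -> OmegaG)).
  apply/integrableP; split; first exact: measurableT_comp mF mid.
  have /integrableP[_] := iF.
  rewrite /m1 /distribution ge0_integral_pushforward//.
  exact: measurableT_comp.
have FE (o : Omega) : (fubini_F m2 (EFin \o h) o =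
    \int[lebesgue_measure]_(r in `[0%R, 1%R]) (h (o, r))%:E)%E.
  apply: integral_uniform_law => //.
  by apply: (measurableT_comp mh); exact: measurable_pair1.
split; first by apply: eq_integrable iFid => // o _; exact: FE.
rewrite hE -(integral12_prod_meas1 ihnu) /m1 /distribution integral_pushforward//.
by apply: eq_integral => o _; exact: FE.
Qed.

End independent_uniform.

(** * The Euclidean inner product and norm *)

Section euclidean.
Context {R : realType} {d : nat}.
Local Notation V := 'rV[R]_d.
Implicit Types (u v w : V) (a : R).

Lemma vdotC u v : vdot u v = vdot v u.
Proof. by apply: eq_bigr => i _; rewrite mulrC. Qed.

Lemma vdotDl u v w : vdot (u + v) w = vdot u w + vdot v w.
Proof. by rewrite -big_split; apply: eq_bigr => i _; rewrite !mxE mulrDl. Qed.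

Lemma vdotZl a u v : vdot (a *: u) v = a * vdot u v.
Proof. by rewrite /vdot mulr_sumr; apply: eq_bigr => i _; rewrite !mxE mulrA. Qed.

Lemma vdotNl u v : vdot (- u) v = - vdot u v.
Proof. by rewrite -scaleN1r vdotZl mulN1r. Qed.

Lemma vdotBl u v w : vdot (u - v) w = vdot u w - vdot v w.
Proof. by rewrite vdotDl vdotNl. Qed.

Lemma vdotDr u v w : vdot u (v + w) = vdot u v + vdot u w.
Proof. by rewrite vdotC vdotDl !(vdotC u). Qed.

Lemma vdotZr a u v : vdot u (a *: v) = a * vdot u v.
Proof. by rewrite vdotC vdotZl vdotC. Qed.

Lemma vdotNr u v : vdot u (- v) = - vdot u v.
Proof. by rewrite vdotC vdotNl vdotC. Qed.

Lemma vdotBr u v w : vdot u (v - w) = vdot u v - vdot u w.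
Proof. by rewrite vdotDr vdotNr. Qed.

Lemma vdot0l v : vdot 0 v = 0.
Proof. by rewrite -(scale0r 0) vdotZl mul0r. Qed.

Lemma vdot_suml (I : Type) (r : seq I) (p : pred I) (f : I -> V) v :
  vdot (\sum_(i <- r | p i) f i) v = \sum_(i <- r | p i) vdot (f i) v.
Proof.
by apply: (big_morph (vdot ^~ v)) => [x y|]; rewrite ?vdotDl// vdot0l.
Qed.

Lemma vdot_ge0 u : 0 <= vdot u u.
Proof. by apply: sumr_ge0 => i _; rewrite -expr2 sqr_ge0. Qed.

Lemma vnorm_ge0 u : 0 <= vnorm u.
Proof. exact: sqrtr_ge0. Qed.

Lemma sqr_vnorm u : vnorm u ^+ 2 = vdot u u.
Proof. by rewrite sqr_sqrtr ?vdot_ge0. Qed.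

Lemma vnormZ a u : vnorm (a *: u) = `|a| * vnorm u.
Proof.
by rewrite /vnorm vdotZl vdotZr mulrA -expr2 sqrtrM ?sqr_ge0// sqrtr_sqr.
Qed.

Lemma vdot_eq0 u : vdot u u = 0 -> u = 0.
Proof.
move=> u0; apply/rowP => i; rewrite mxE; apply/eqP.
rewrite -sqrf_eq0 expr2; apply/eqP; move: u0.
rewrite /vdot => /eqP; rewrite psumr_eq0; last first.
  by move=> j _; rewrite -expr2 sqr_ge0.
by move=> /allP/(_ i (mem_index_enum _))/eqP.
Qed.

(** The squared norm of [|v|^2 u - <u, v> v] equals [|v|^2] times the gap between the two sides. *)
Lemma vdot_sqr_le u v : vdot u v ^+ 2 <= vdot u u * vdot v v.
Proof.
have [v0|v0] := eqVneq (vdot v v) 0.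
  by rewrite (vdot_eq0 v0) vdotC !vdot0l mulr0 expr0n.
have vp : 0 < vdot v v by rewrite lt_def v0 vdot_ge0.
have := vdot_ge0 (vdot v v *: u - vdot u v *: v).
rewrite vdotBl !vdotBr !vdotZl !vdotZr (vdotC v u) => h.
rewrite -subr_ge0 -(pmulr_rge0 _ vp); move: h.
by congr (_ <= _); ring.
Qed.

Lemma vdot_le_vnormM u v : `|vdot u v| <= vnorm u * vnorm v.
Proof.
rewrite -(ler_pXn2r (n := 2))// ?nnegrE ?mulr_ge0 ?vnorm_ge0//.
by rewrite real_normK ?num_real// exprMn !sqr_vnorm vdot_sqr_le.
Qed.

Lemma vnorm_coord_le u i : `|u ord0 i| <= vnorm u.
Proof.
rewrite -(ler_pXn2r (n := 2))// ?nnegrE ?vnorm_ge0// sqr_vnorm.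
rewrite real_normK ?num_real// /vdot (bigD1 i)//= -expr2 lerDl.
by apply: sumr_ge0 => j _; rewrite -expr2 sqr_ge0.
Qed.

(* AM-GM: [- 2 <u, v> <= eta |u|^2 + |v|^2 / eta]. *)
Lemma vdotB_young (eta : R) u v : 0 < eta ->
  vdot (u - v) (u - v) <= (1 + eta) * vdot u u + (1 + eta^-1) * vdot v v.
Proof.
move=> e0; have := vdot_ge0 (eta *: u + v).
rewrite !vdotBl !vdotBr !vdotDl !vdotDr !vdotZl !vdotZr (vdotC v u) => h.
rewrite -subr_ge0 -(pmulr_rge0 _ e0); move: h; congr (_ <= _).
by field; rewrite gt_eqF.
Qed.

End euclidean.

(** * Finitely supported laws as candidates in the infimum [lam_norm] *)

Section finite_support.
Context {R : realType}.
Variables (q : nat -> R) (q0 : forall k, 0 <= q k) (n : nat).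
Hypothesis q1 : \sum_(k < n) q k = 1.

(** The mass sits on the indices rather than on the points: every [Y : nat -> V] is then a random
    vector whose law has weight [q k] at [Y k]. *)
Definition finite_law : set nat -> \bar R :=
  msum (fun k => mscale (NngNum (q0 k)) \d_k) n.

HB.instance Definition _ := Measure.on finite_law.

Let finite_law_setT : finite_law setT = 1%E.
Proof.
rewrite /finite_law /msum -[RHS]/(1%:E) -q1 -sumEFin; apply: eq_bigr => k _.
transitivity ((q k)%:E * \d_(k : nat) [set: nat])%E; first by [].
by rewrite diracT mule1.
Qed.

Definition finite_law_probability : probability nat R :=
  HB.pack finite_law
   (@Measure_isProbability.Build _ _ _ finite_law finite_law_setT).

Let ge0_integral_finite_law (f : nat -> R) : (forall k, 0 <= f k) ->
  (\int[finite_law_probability]_k (f k)%:E = (\sum_(k < n) q k * f k)%:E)%E.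
Proof.
move=> f0; transitivity (\int[finite_law]_k (f k)%:E)%E; first by [].
rewrite ge0_integral_measure_sum//; last by move=> k _; rewrite lee_fin.
rewrite -sumEFin; apply: eq_bigr => k _.
rewrite ge0_integral_mscale//; last by move=> j _; rewrite lee_fin.
by rewrite integral_dirac// diracT mul1e.
Qed.

Lemma integrable_finite_law (f : nat -> R) :
  finite_law_probability.-integrable setT (fun k => (f k)%:E).
Proof.
apply/integrableP; split => //.
under eq_integral do rewrite abse_EFin.
by rewrite (ge0_integral_finite_law (f := fun k => `|f k|))// ltry.
Qed.

Lemma integral_finite_law (f : nat -> R) :
  (\int[finite_law_probability]_k (f k)%:E = (\sum_(k < n) q k * f k)%:E)%E.
Proof.
transitivity (\int[finite_law_probability]_k
    ((Num.max (f k) 0)%:E - (Num.max (- f k) 0)%:E))%E.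
  apply: eq_integral => k _; rewrite -EFinB; congr (_%:E).
  by rewrite /Num.max; case: ltP => ?; case: ltP => ?; lra.
rewrite (integralB _ (integrable_finite_law (fun k => Num.max (f k) 0))
  (integrable_finite_law (fun k => Num.max (- f k) 0)))//.
rewrite !ge0_integral_finite_law; first last.
- by move=> k; rewrite le_max lexx orbT.
- by move=> k; rewrite le_max lexx orbT.
rewrite -EFinB -sumrB; congr (_%:E); apply: eq_bigr => k _; rewrite -mulrBr.
congr (_ * _); by rewrite /Num.max; case: ltP => ?; case: ltP => ?; lra.
Qed.

End finite_support.

Lemma lam_norm_le_finite (R : realType) (d : nat) (F : 'rV[R]_d -> R) (lam : R)
    (n : nat) (q : nat -> R) (Y : nat -> 'rV[R]_d) (z : 'rV[R]_d) :
  (forall k, 0 <= q k) -> \sum_(k < n) q k = 1 ->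
  z = \sum_(k < n) q k *: Y k ->
  (lam_norm F lam z <= (vnorm (\sum_(k < n) q k *: grad F (Y k))
    + lam * \sum_(k < n) q k * vnorm (Y k - z) ^+ 2)%:E)%E.
Proof.
move=> q0 q1 zE; apply: ereal_inf_lbound.
have vExE (W : nat -> 'rV[R]_d) :
    vEx (finite_law_probability q0 q1) W = \sum_(k < n) q k *: W k.
  apply/rowP => i; rewrite mxE integral_finite_law/= summxE.
  by apply: eq_bigr => k _; rewrite mxE.
exists _, nat, (finite_law_probability q0 q1), Y; split.
- by move=> i; exact: integrable_finite_law.
- by move=> i; exact: integrable_finite_law.
- by rewrite vExE zE.
- by rewrite vExE integral_finite_law EFinD EFinM.
Qed.

Lemma lam_norm_ge0 (R : realType) (d : nat) (F : 'rV[R]_d -> R) (lam : R)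
    (z : 'rV[R]_d) : 0 <= lam -> (0 <= lam_norm F lam z)%E.
Proof.
move=> lam0; apply: le_ereal_inf_tmp => _ [? [? [Q [W [_ _ _ ->]]]]].
rewrite adde_ge0 ?lee_fin ?vnorm_ge0// mule_ge0 ?lee_fin//.
by apply: integral_ge0 => o _; rewrite lee_fin sqr_ge0.
Qed.

(** * Discounted sums and the weights that undo the discounting *)

Section discounted_sums.
Context {R : realType}.
Variable beta : R.

Definition dsum (a : nat -> R) (t : nat) : R :=
  \sum_(1 <= k < t.+1) beta ^+ (t - k) * a k.

Definition dsumv {d : nat} (a : nat -> 'rV[R]_d) (t : nat) : 'rV[R]_d :=
  \sum_(1 <= k < t.+1) beta ^+ (t - k) *: a k.

Lemma dsum0 a : dsum a 0 = 0.
Proof. by rewrite /dsum big_geq. Qed.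

Lemma dsumS a t : dsum a t.+1 = beta * dsum a t + a t.+1.
Proof.
rewrite /dsum big_nat_recr//= subnn expr0 mul1r mulr_sumr; congr (_ + _).
apply: eq_big_nat => k /andP[_ kt].
by rewrite subSn// exprS mulrA.
Qed.

Lemma dsumv0 d (a : nat -> 'rV[R]_d) : dsumv a 0 = 0.
Proof. by rewrite /dsumv big_geq. Qed.

Lemma dsumvS d (a : nat -> 'rV[R]_d) t :
  dsumv a t.+1 = beta *: dsumv a t + a t.+1.
Proof.
rewrite /dsumv big_nat_recr//= subnn expr0 scale1r scaler_sumr; congr (_ + _).
apply: eq_big_nat => k /andP[_ kt].
by rewrite subSn// exprS scalerA.
Qed.

Lemma dsumvD d (a b : nat -> 'rV[R]_d) t :
  dsumv (fun k => a k + b k) t = dsumv a t + dsumv b t.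
Proof.
by rewrite /dsumv -big_split; apply: eq_bigr => k _; rewrite scalerDr.
Qed.

(** In the sum of the increments [S t - beta * S t.-1], each [S t] with [t < T] is charged [beta] by
    the next round, whereas [S T] is charged nothing; hence the full last weight. *)
Definition weight (T t : nat) : R := if (t < T)%N then 1 - beta else 1.

(* Undoes the discounting: [S t - beta * S t.-1] recovers the undiscounted
   increment. *)
Lemma weight_telescope (S : nat -> R) T : S 0%N = 0 ->
  \sum_(1 <= t < T.+1) weight T t * S t =
  \sum_(1 <= t < T.+1) (S t - beta * S t.-1).
Proof.
move=> S0; elim: T => [|T IH]; first by rewrite !big_geq.
rewrite [RHS]big_nat_recr//= -IH big_nat_recr//= /weight ltnn.
case: T IH => [_|T _]; first by rewrite !big_geq//= S0; ring.
rewrite !(big_nat_recr T.+1)//= ltnSn ltnn.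
rewrite [X in X + _ + _ = _](_ : _ = \sum_(1 <= t < T.+1) (1 - beta) * S t); last first.
  by apply: eq_big_nat => t /andP[_ tT]; rewrite (ltn_trans tT).
rewrite [X in _ = X + _ + _](_ : _ = \sum_(1 <= t < T.+1) (1 - beta) * S t); last first.
  by apply: eq_big_nat => t /andP[_ tT]; rewrite tT.
ring.
Qed.

Lemma weight_dsum a T :
  \sum_(1 <= t < T.+1) weight T t * dsum a t = \sum_(1 <= t < T.+1) a t.
Proof.
rewrite weight_telescope ?dsum0//; apply: eq_big_nat => -[//|t] _ /=.
by rewrite dsumS addrAC subrr add0r.
Qed.

Hypotheses (b0 : 0 < beta) (b1 : beta < 1).

Lemma weight_ge0 T t : 0 <= weight T t.
Proof. by rewrite /weight; case: ifP => // _; rewrite subr_ge0 ltW. Qed.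

Lemma dsum1 t : dsum (fun=> 1) t = (1 - beta ^+ t) / (1 - beta).
Proof.
elim: t => [|t IH]; first by rewrite dsum0 expr0 subrr mul0r.
by rewrite dsumS IH exprS; field; rewrite subr_eq0 gt_eqF.
Qed.

Lemma dsum1_le t : dsum (fun=> 1) t <= (1 - beta)^-1.
Proof.
rewrite dsum1; apply: ler_piMl; first by rewrite invr_ge0 subr_ge0 ltW.
by rewrite lerBlDr lerDl exprn_ge0// ltW.
Qed.

Lemma expr_lt1 t : (0 < t)%N -> beta ^+ t < 1.
Proof. by move=> t0; rewrite exprn_ilt1 ?ltW// -lt0n. Qed.

Lemma dsum_ge0 a t : (forall k, 0 <= a k) -> 0 <= dsum a t.
Proof. by move=> a0; apply: sumr_ge0 => k _; rewrite mulr_ge0// exprn_ge0 ?ltW. Qed.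

(** For [T > 0] the sum equals [(1 - beta) T + beta], and [1 <= (1 - beta) T] bounds the extra
    [beta] by [beta (1 - beta) T]. *)
Lemma sum_weight_le T : (1 - beta)^-1 <= T%:R ->
  \sum_(1 <= t < T.+1) weight T t <= (1 - beta) * (1 + beta) * T%:R.
Proof.
case: T => [|T]; first by rewrite leNgt invr_gt0 subr_gt0 b1.
move=> hT; rewrite big_nat_recr//= /weight ltnn.
rewrite [X in X + _ <= _](_ : _ = \sum_(1 <= t < T.+1) (1 - beta)); last first.
  by apply: eq_big_nat => t /andP[_ tT]; rewrite tT.
rewrite sumr_const_nat subSS subn0 -mulr_natr.
have h : 1 <= (1 - beta) * T.+1%:R.
  by rewrite -ler_pdivrMl ?mulr1// subr_gt0.
move: h; rewrite -subr_ge0 => /(mulr_ge0 (ltW b0)) h.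
rewrite -subr_ge0; move: h; congr (_ <= _); rewrite -natr1; ring.
Qed.

(** The factor [(1 - beta^t) / (1 - beta)] is the inverse of the EMA normalisation and cancels it
    when bounds at the EMA are averaged over [tau]. *)
Lemma tau_probE T t : (0 < T)%N -> (t <= T)%N ->
  tau_prob beta T t = T%:R^-1 * (weight T t * ((1 - beta ^+ t) / (1 - beta))).
Proof.
move=> T0 tT; rewrite /tau_prob /weight.
have b1' : 1 - beta != 0 by rewrite subr_eq0 gt_eqF.
have T0' : T%:R != 0 :> R by rewrite pnatr_eq0 -lt0n.
case: ltnP => [_|Tt]; first by field; rewrite b1' T0'.
have -> : t = T by apply/eqP; rewrite eqn_leq tT Tt.
by field; rewrite b1' T0'.
Qed.

End discounted_sums.

(** * The discounted spread of the query points around the current iterate *)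

Section discounted_spread.
Context {R : realType} {d : nat}.
Variables (beta : R) (x y : nat -> 'rV[R]_d).
Hypotheses (b0 : 0 < beta) (b1 : beta < 1).

Definition spread (t : nat) : R :=
  dsum beta (fun k => vnorm (y k - x t) ^+ 2) t.

Lemma spread_ge0 t : 0 <= spread t.
Proof. by apply: dsum_ge0 => // k; rewrite sqr_ge0. Qed.

(* [vdotB_young] with [eta = (1 - beta) / (2 * beta)], for which
   [beta * (1 + eta) = (1 + beta) / 2]. *)
Lemma spreadS_le t : spread t.+1 <= (1 + beta) / 2 * spread t
  + 2 / (1 - beta) ^+ 2 * vnorm (x t.+1 - x t) ^+ 2
  + vnorm (y t.+1 - x t.+1) ^+ 2.
Proof.
rewrite {1}/spread dsumS lerD2r.
pose eta := (1 - beta) / (2 * beta).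
have e0 : 0 < eta by rewrite divr_gt0 ?subr_gt0 ?mulr_gt0.
have step : dsum beta (fun k => vnorm (y k - x t.+1) ^+ 2) t <=
    (1 + eta) * spread t +
    (1 + eta^-1) * vnorm (x t.+1 - x t) ^+ 2 * dsum beta (fun=> 1) t.
  rewrite /spread /dsum !mulr_sumr -big_split/=.
  apply: ler_sum => k _; have bk : 0 <= beta ^+ (t - k) by rewrite exprn_ge0// ltW.
  rewrite mulr1 !(mulrCA _ (beta ^+ _)) (mulrC (_ * _) (beta ^+ _)) -mulrDr.
  rewrite ler_wpM2l// !sqr_vnorm.
  have -> : y k - x t.+1 = (y k - x t) - (x t.+1 - x t).
    by rewrite opprB addrA subrK.
  exact: vdotB_young.
have := ler_wpM2l (ltW b0) step; move/le_trans; apply.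
rewrite mulrDr mulrA; apply: lerD.
  by rewrite le_eqVlt; apply/orP; left; apply/eqP; congr (_ * _);
     rewrite /eta; field; rewrite gt_eqF.
have -> : beta * ((1 + eta^-1) * vnorm (x t.+1 - x t) ^+ 2 * dsum beta (fun=> 1) t) =
    beta * (1 + eta^-1) * dsum beta (fun=> 1) t * vnorm (x t.+1 - x t) ^+ 2.
  by ring.
rewrite ler_wpM2r ?sqr_ge0//.
have c0 : 0 <= beta * (1 + eta^-1).
  by rewrite mulr_ge0 ?addr_ge0 ?invr_ge0 ?ltW.
apply: le_trans (ler_wpM2l c0 (dsum1_le b0 b1 t)) _.
have -> : beta * (1 + eta^-1) / (1 - beta) = beta * (1 + beta) / (1 - beta) ^+ 2.
  by rewrite /eta; field; rewrite subr_eq0 !gt_eqF.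
rewrite ler_wpM2r ?invr_ge0 ?sqr_ge0//.
have -> : 2 = 1 * (1 + 1) :> R by ring.
by rewrite ler_pM ?lerD// ?addr_ge0// ltW.
Qed.

(** Telescoping at the rate [gamma] of the contraction leaves only the source terms of [spreadS_le].
    Since [1 - gamma = (1 - beta) / 2], passing from [beta]-weights to [gamma]-weights costs a
    factor of at most 2. *)
Lemma sum_weight_spread_le T :
  \sum_(1 <= t < T.+1) weight beta T t * spread t <=
  4 / (1 - beta) ^+ 2 * \sum_(1 <= t < T.+1) vnorm (x t - x t.-1) ^+ 2
  + 2 * \sum_(1 <= t < T.+1) vnorm (y t - x t) ^+ 2.
Proof.
pose gamma := (1 + beta) / 2.
apply: (@le_trans _ _ (2 * \sum_(1 <= t < T.+1) weight gamma T t * spread t)).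
  rewrite mulr_sumr; apply: ler_sum => t _.
  rewrite mulrA ler_wpM2r ?spread_ge0// /weight /gamma.
  by case: ifP => _; lra.
rewrite weight_telescope; last by rewrite /spread dsum0.
have -> : 4 / (1 - beta) ^+ 2 = 2 * (2 / (1 - beta) ^+ 2) by field; rewrite subr_eq0 gt_eqF.
rewrite -mulrA -mulrDr ler_pM2l// mulr_sumr -big_split/= big_nat [leRHS]big_nat.
apply: ler_sum => -[//|t] _ /=.
by rewrite lerBlDl addrA; exact: spreadS_le.
Qed.

End discounted_spread.

(** * Bounding [lam_norm] at the moving average *)

(** Bias-variance decomposition: moving the centre from the mean [z] to [c] adds [|z - c|^2],
    because the cross term is centred. *)
Lemma sum_sqr_vnorm_mean_le (R : realType) (d n : nat) (q : nat -> R)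
    (Y : nat -> 'rV[R]_d) (z c : 'rV[R]_d) :
  \sum_(k < n) q k = 1 -> z = \sum_(k < n) q k *: Y k ->
  \sum_(k < n) q k * vnorm (Y k - z) ^+ 2 <=
  \sum_(k < n) q k * vnorm (Y k - c) ^+ 2.
Proof.
move=> q1 zE.
have -> : \sum_(k < n) q k * vnorm (Y k - c) ^+ 2 =
    \sum_(k < n) q k * vnorm (Y k - z) ^+ 2 + vnorm (z - c) ^+ 2
    + 2 * vdot (\sum_(k < n) q k *: (Y k - z)) (z - c).
  have -> : vnorm (z - c) ^+ 2 = \sum_(k < n) q k * vnorm (z - c) ^+ 2.
    by rewrite -mulr_suml q1 mul1r.
  rewrite vdot_suml mulr_sumr -!big_split/=.
  apply: eq_bigr => k _.
  have -> : Y k - c = (Y k - z) + (z - c) by rewrite addrA subrK.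
  move: (Y k - z) (z - c) => a b.
  by rewrite !sqr_vnorm vdotZl vdotDl !vdotDr (vdotC b a); ring.
have -> : \sum_(k < n) q k *: (Y k - z) = 0.
  under eq_bigr do rewrite scalerBr.
  by rewrite sumrB -scaler_suml q1 scale1r -zE subrr.
by rewrite vdot0l mulr0 addr0 lerDl sqr_ge0.
Qed.

(** The EMA weights form a probability whose mean is the EMA. The free centre [c] allows the spread
    to be measured from [x_t], for which a recursion is available. *)
Lemma lam_norm_ema_le (R : realType) (d : nat) (F : 'rV[R]_d -> R) (lam beta : R)
    (T : Type) (y : nat -> T -> 'rV[R]_d) (t : nat) (o : T) (c : 'rV[R]_d) :
  0 <= lam -> 0 < beta -> beta < 1 -> (0 < t)%N ->
  (lam_norm F lam (ema beta y t o) <=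
   ((1 - beta) / (1 - beta ^+ t) *
     (vnorm (dsumv beta (fun k => grad F (y k o)) t)
      + lam * dsum beta (fun k => vnorm (y k o - c) ^+ 2) t))%:E)%E.
Proof.
move=> lam0 b0 b1 t0; set r := (1 - beta) / (1 - beta ^+ t).
have bt : 0 < 1 - beta ^+ t by rewrite subr_gt0 expr_lt1.
have r0 : 0 < r by rewrite divr_gt0// subr_gt0.
(* Rounds are numbered from 1 and ordinals from 0, so index [k] stands for round [k.+1]. *)
pose q k := r * beta ^+ (t - k.+1).
have shift (M : zmodType) (f : nat -> M) :
    \sum_(1 <= k < t.+1) f k = \sum_(k < t) f k.+1.
  by rewrite big_add1/= big_mkord.
have q0 k : 0 <= q k by rewrite mulr_ge0 ?exprn_ge0 ?ltW.
have q1 : \sum_(k < t) q k = 1.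
  rewrite -mulr_sumr -(shift _ (fun k => beta ^+ (t - k))).
  have := dsum1 b1 t; rewrite /dsum; under eq_bigr do rewrite mulr1.
  by move=> ->; rewrite /r; field; rewrite (gt_eqF bt) subr_eq0 gt_eqF.
have emaE : ema beta y t o = \sum_(k < t) q k *: y k.+1 o.
  rewrite /ema -/r scaler_sumr shift; apply: eq_bigr => k _.
  by rewrite scalerA.
apply: le_trans (@lam_norm_le_finite _ _ F lam t q (fun k => y k.+1 o) _ q0 q1 emaE) _.
rewrite lee_fin mulrDr; apply: lerD => /=.
  have -> : \sum_(k < t) q k *: grad F (y k.+1 o) =
      r *: dsumv beta (fun k => grad F (y k o)) t.
    by rewrite /dsumv shift scaler_sumr; apply: eq_bigr => k _; rewrite scalerA.
  by rewrite vnormZ ger0_norm// ltW.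
rewrite mulrCA ler_wpM2l// /dsum shift mulr_sumr.
apply: le_trans (@sum_sqr_vnorm_mean_le _ _ t q (fun k => y k.+1 o) _ c q1 emaE) _.
by apply: ler_sum => k _; rewrite /q -mulrA.
Qed.

(** * Real-valued expectations *)

Section real_expectation.
Context {R : realType} {dO : measure_display} {Omega : measurableType dO}.
Variable P : probability Omega R.
Implicit Types f g : Omega -> R.

Definition L1 f : Prop := P.-integrable setT (EFin \o f).

(** An infinite integral would be read as 0 here; [ExE] links [Ex] to the extended integral for [L1]
    functions. *)
Definition Ex f : R := Rintegral P setT f.

Lemma ExE f : L1 f -> (\int[P]_o (f o)%:E = (Ex f)%:E)%E.
Proof. by move=> If; rewrite /Ex /Rintegral fineK//; exact: integrable_fin_num. Qed.

Lemma L1_le f g : measurable_fun setT f -> L1 g -> (forall o, `|f o| <= g o) -> L1 f.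
Proof.
move=> mf Ig fg; apply: le_integrable Ig => //; first exact/measurable_EFinP.
by move=> o _; rewrite lee_fin (le_trans (fg o)) ?ler_norm.
Qed.

Lemma L1_cst (c : R) : L1 (fun=> c).
Proof. exact: finite_measure_integrable_cst. Qed.

Lemma Ex_cst (c : R) : Ex (fun=> c) = c.
Proof. rewrite /Ex (Rintegral_cst P measurableT c).
have -> : fine (P setT) = 1 by rewrite probability_setT.
by rewrite mulr1. Qed.

Lemma L1_bounded f (c : R) : measurable_fun setT f -> (forall o, `|f o| <= c) -> L1 f.
Proof. by move=> mf fc; apply: (@L1_le _ (fun=> c)) => //; exact: L1_cst. Qed.

Lemma L1D f g : L1 f -> L1 g -> L1 (fun o => f o + g o).
Proof. by move=> If Ig; exact: (integrableD measurableT If Ig). Qed.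

Lemma L1Z (c : R) f : L1 f -> L1 (fun o => c * f o).
Proof. by move=> If; exact: (integrableZl measurableT c If). Qed.

Lemma L1B f g : L1 f -> L1 g -> L1 (fun o => f o - g o).
Proof. by move=> If Ig; exact: (integrableB measurableT If Ig). Qed.

Lemma L1_sum (I : eqType) (r : seq I) (F : I -> Omega -> R) :
  (forall i, i \in r -> L1 (F i)) -> L1 (fun o => \sum_(i <- r) F i o).
Proof.
elim: r => [_|i r IH h].
  by under [X in L1 X]eq_fun do rewrite big_nil; exact: L1_cst.
under [X in L1 X]eq_fun do rewrite big_cons; apply: L1D.
  by apply: h; rewrite mem_head.
by apply: IH => j jr; apply: h; rewrite in_cons jr orbT.
Qed.

Lemma measurable_sum_in (I : eqType) (r : seq I) (F : I -> Omega -> R) :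
  (forall i, i \in r -> measurable_fun setT (F i)) ->
  measurable_fun setT (fun o => \sum_(i <- r) F i o).
Proof.
elim: r => [_|i r IH h].
  by under eq_fun do rewrite big_nil; exact: measurable_cst.
under eq_fun do rewrite big_cons; apply: measurable_funD.
  by apply: h; rewrite mem_head.
by apply: IH => j jr; apply: h; rewrite in_cons jr orbT.
Qed.

Lemma ExD f g : L1 f -> L1 g -> Ex (fun o => f o + g o) = Ex f + Ex g.
Proof. by move=> If Ig; rewrite /Ex RintegralD. Qed.

Lemma ExZ (c : R) f : L1 f -> Ex (fun o => c * f o) = c * Ex f.
Proof. by move=> If; rewrite /Ex RintegralZl. Qed.

Lemma Ex_sum (I : eqType) (r : seq I) (F : I -> Omega -> R) :
  (forall i, i \in r -> L1 (F i)) ->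
  Ex (fun o => \sum_(i <- r) F i o) = \sum_(i <- r) Ex (F i).
Proof.
elim: r => [_|i r IH h].
  by under [X in Ex X]eq_fun do rewrite big_nil; rewrite big_nil Ex_cst.
under [X in Ex X]eq_fun do rewrite big_cons.
have hr j : j \in r -> L1 (F j) by move=> jr; apply: h; rewrite in_cons jr orbT.
rewrite ExD ?big_cons ?IH//; last exact: L1_sum.
by apply: h; rewrite mem_head.
Qed.

Lemma le_Ex f g : L1 f -> L1 g -> (forall o, f o <= g o) -> Ex f <= Ex g.
Proof. by move=> If Ig fg; apply: le_Rintegral. Qed.

Lemma L1_ge0P f : measurable_fun setT f -> (forall o, 0 <= f o) ->
  (\int[P]_o (f o)%:E < +oo)%E -> L1 f.
Proof.
move=> mf f0 h; apply/integrableP; split; first exact/measurable_EFinP.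
by under eq_integral do rewrite /= ger0_norm//.
Qed.

(* [f] need not be measurable: the integral of a nonnegative function is a
   supremum over the simple functions below it. *)
Lemma ge0_integral_mono (f g : Omega -> \bar R) :
  (forall o, 0 <= f o)%E -> (forall o, f o <= g o)%E ->
  (\int[P]_o f o <= \int[P]_o g o)%E.
Proof.
move=> f0 fg; have g0 o : (0 <= g o)%E := le_trans (f0 o) (fg o).
rewrite !ge0_integralE//; apply: ereal_sup_le => _ [h hf <-].
exists h => // o; rewrite !patch_setT in hf *.
exact: le_trans (hf o) (fg o).
Qed.

End real_expectation.

(** Inversion is continuous off 0, and the remaining singleton is measurable. This serves the
    normalised comparator of the regret bound. *)
Lemma measurable_inv (R : realType) : measurable_fun setT (fun r : R => r^-1).
Proof.
have -> : setT = [set 0] `|` ~` [set 0] :> set R by rewrite setUv.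
apply/measurable_funU; [by []|exact: measurableC|split].
  exact: measurable_fun_set1.
apply: open_continuous_measurable_fun.
  exact/closed_openC/closed_eq.
move=> r; rewrite inE => /eqP r0.
exact: inv_continuous.
Qed.

(** * Square-integrable random vectors *)

Section square_integrable.
Context {R : realType} {dO : measure_display} {Omega : measurableType dO} {d : nat}.
Variable P : probability Omega R.
Local Notation V := 'rV[R]_d.
Implicit Types X Y : Omega -> V.

Definition measurable_vec X : Prop :=
  forall i, measurable_fun setT (fun o => X o ord0 i).

Definition L2 X : Prop := measurable_vec X /\ L1 P (fun o => vdot (X o) (X o)).

Lemma measurable_vdot X Y : measurable_vec X -> measurable_vec Y ->
  measurable_fun setT (fun o => vdot (X o) (Y o)).
Proof.
by move=> mX mY; apply: measurable_sum => i; exact: measurable_funM.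
Qed.

Lemma measurable_vnorm X : measurable_vec X ->
  measurable_fun setT (fun o => vnorm (X o)).
Proof.
move=> mX; apply: (measurableT_comp (f := @Num.sqrt R)); last exact: measurable_vdot.
by apply: continuous_measurable_fun; exact: sqrt_continuous.
Qed.

Lemma measurable_vecD X Y : measurable_vec X -> measurable_vec Y ->
  measurable_vec (fun o => X o + Y o).
Proof.
by move=> mX mY i; under eq_fun do rewrite mxE; exact: measurable_funD.
Qed.

Lemma measurable_vecZ (a : Omega -> R) X : measurable_fun setT a ->
  measurable_vec X -> measurable_vec (fun o => a o *: X o).
Proof.
by move=> ma mX i; under eq_fun do rewrite mxE; exact: measurable_funM.
Qed.

Lemma measurable_vecN X : measurable_vec X -> measurable_vec (fun o => - X o).
Proof.
by move=> mX i; under eq_fun do rewrite mxE; exact: measurableT_comp.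
Qed.

Lemma measurable_vecB X Y : measurable_vec X -> measurable_vec Y ->
  measurable_vec (fun o => X o - Y o).
Proof. by move=> mX mY; apply: measurable_vecD => //; exact: measurable_vecN. Qed.

Lemma L2_bounded X (c : R) : measurable_vec X -> (forall o, vnorm (X o) <= c) -> L2 X.
Proof.
move=> mX Xc; split => //; apply: (@L1_bounded _ _ _ _ _ (c ^+ 2)).
  exact: measurable_vdot.
move=> o; rewrite ger0_norm ?vdot_ge0// -sqr_vnorm.
by rewrite lerXn2r ?nnegrE ?vnorm_ge0// (le_trans (vnorm_ge0 _) (Xc o)).
Qed.

Lemma vdot_young (u v : V) : `|vdot u v| <= vdot u u + vdot v v.
Proof.
have h1 := vdot_ge0 (u + v); have h2 := vdot_ge0 (u - v).
have := vdot_ge0 u; have := vdot_ge0 v.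
move: h1 h2; rewrite !vdotDl !vdotDr !vdotNl !vdotNr (vdotC v u).
by rewrite ler_norml; lra.
Qed.

Lemma L1_vdot X Y : L2 X -> L2 Y -> L1 P (fun o => vdot (X o) (Y o)).
Proof.
move=> [mX IX] [mY IY]; apply: (@L1_le _ _ _ _ _ _ _ (L1D IX IY)).
  exact: measurable_vdot.
by move=> o; exact: vdot_young.
Qed.

Lemma L2D X Y : L2 X -> L2 Y -> L2 (fun o => X o + Y o).
Proof.
move=> LX LY; split; first exact: measurable_vecD LX.1 LY.1.
under [F in L1 _ F]eq_fun do rewrite vdotDl !vdotDr.
by apply: L1D; apply: L1D; exact: L1_vdot.
Qed.

Lemma L2Z (c : R) X : L2 X -> L2 (fun o => c *: X o).
Proof.
move=> LX; split; first exact: (measurable_vecZ _ LX.1).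
under [F in L1 _ F]eq_fun do rewrite vdotZl vdotZr mulrA.
by apply: L1Z; exact: LX.2.
Qed.

Lemma L2_cst (v : V) : L2 (fun=> v).
Proof. by split; [move=> i; exact: measurable_cst|exact: L1_cst]. Qed.

Lemma L2_coord X i : L2 X -> L1 P (fun o => X o ord0 i).
Proof.
move=> LX; have := L1_vdot LX (L2_cst (delta_mx ord0 i)).
have -> // : (fun o => vdot (X o) (delta_mx ord0 i)) = (fun o => X o ord0 i).
apply/funext => o; rewrite /vdot (bigD1 i)//= mxE !eqxx mulr1 big1 ?addr0//.
by move=> j ji; rewrite mxE (negbTE ji) andbF mulr0.
Qed.

Lemma L1_coordM X Y i : L2 X -> L2 Y -> L1 P (fun o => X o ord0 i * Y o ord0 i).
Proof.
move=> LX LY; apply: (@L1_le _ _ _ _ _ _ _ (L1D LX.2 LY.2)).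
  exact: measurable_funM (LX.1 i) (LY.1 i).
move=> o; rewrite normrM.
have hX := vnorm_coord_le (X o) i; have hY := vnorm_coord_le (Y o) i.
rewrite -!sqr_vnorm (le_trans (ler_pM _ _ hX hY))//.
have := sqr_ge0 (vnorm (X o) - vnorm (Y o)).
have := sqr_ge0 (vnorm (X o)); have := sqr_ge0 (vnorm (Y o)).
by rewrite sqrrB; lra.
Qed.

End square_integrable.

(** * Conditional expectations within one round *)

Section one_round.
Context {R : realType} {dO : measure_display} {Omega : measurableType dO} {d : nat}.
Variable P : probability Omega R.
Local Notation V := 'rV[R]_d.
Implicit Types X Y Z : Omega -> V.

Lemma Gmeas_v_measurable (Hs : set (set Omega)) X :
  Hs `<=` measurable -> Gmeas_v Hs X -> measurable_vec X.
Proof. by move=> sH mX i; exact: (Gmeas_measurable sH (mX i)). Qed.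

Lemma Ex_vdot_pull_out0 (Hs : set (set Omega)) Z X :
  sigma_algebra setT Hs -> Hs `<=` measurable -> Gmeas_v Hs Z ->
  L2 P Z -> L2 P X ->
  (forall A i, Hs A -> (\int[P]_(o in A) (X o ord0 i)%:E = 0)%E) ->
  Ex P (fun o => vdot (Z o) (X o)) = 0.
Proof.
move=> sH subH GZ LZ LX X0.
rewrite /vdot Ex_sum => [|i _]; last exact: L1_coordM.
apply: big1 => i _; rewrite /Ex /Rintegral.
rewrite (@integral_pull_out0 _ _ _ P Hs sH subH (fun o => X o ord0 i))//.
- exact: L2_coord.
- by move=> A HA; exact: X0.
- exact: L1_coordM.
Qed.

(** [x] and [Delta] are known before [s] is drawn, so [h] separates the past from the uniform
    variable. Integrating [s] out leaves the line integral, which is the increment of [F]; the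
    integrability of that increment also comes from Fubini. *)
Lemma expected_increment (F : V -> R) (G : R) (Gs : set (set Omega))
    (x Delta : Omega -> V) (s : Omega -> R) :
  (forall z, differentiable F z) ->
  (forall z w, (\int[lebesgue_measure]_(t in `[0%R, 1%R]%classic)
    (vdot (grad F (w + t *: (z - w))) (z - w))%:E = (F z - F w)%:E)%E) ->
  (forall z, vnorm (grad F z) <= G) ->
  sigma_algebra setT Gs -> Gs `<=` measurable ->
  Gmeas_v Gs x -> Gmeas_v Gs Delta -> L2 P Delta -> measurable_fun setT s ->
  (forall A B, Gs A -> measurable B ->
    P (A `&` s @^-1` B) = (P A * lebesgue_measure (B `&` `[0%R, 1%R]))%E) ->
  L1 P (fun o => F (x o + Delta o) - F (x o)) /\
  Ex P (fun o => vdot (grad F (x o + s o *: Delta o)) (Delta o)) =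
  Ex P (fun o => F (x o + Delta o) - F (x o)).
Proof.
move=> dF intF bF sG subG Gx GD LD ms indep.
pose h (p : g_sigma_algebraType Gs * measurableTypeR R) : R :=
  vdot (grad F (x p.1 + p.2 *: Delta p.1)) (Delta p.1).
have mcoord (X : Omega -> V) : Gmeas_v Gs X ->
    measurable_vec (fun p : g_sigma_algebraType Gs * measurableTypeR R => X p.1).
  move=> GX i; apply: (measurableT_comp (f := fun o : g_sigma_algebraType Gs => X o ord0 i)) => //.
  by apply/(GmeasE sG); exact: GX.
have mh : measurable_fun setT h.
  apply: measurable_vdot; last exact: mcoord.
  move=> i; apply: measurable_grad_comp => // j.
  move: j; apply: measurable_vecD; first exact: mcoord.
  by apply: measurable_vecZ; [exact: measurable_snd|exact: mcoord].
have mx := Gmeas_v_measurable subG Gx.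
have mD := LD.1.
have ih : L1 P (fun o : Omega => h (o, s o)).
  apply: L1_vdot => //; apply: (@L2_bounded _ _ _ _ _ _ G) => // i.
  apply: measurable_grad_comp => //.
  by apply: measurable_vecD => //; exact: measurable_vecZ.
have [iI hE] := integral_independent_uniform sG subG ms indep mh ih.
have incr (o : Omega) : (\int[lebesgue_measure]_(r in `[0%R, 1%R]) (h (o, r))%:E =
    (F (x o + Delta o) - F (x o))%:E)%E.
  by rewrite -intF (addrC (x o)) addrK.
split; first by apply: eq_integrable iI => // o _; rewrite incr.
by rewrite /Ex /Rintegral hE; congr fine; apply: eq_integral => o _; rewrite incr.
Qed.

End one_round.

(** * Discounted sums of random vectors *)

Section discounted_random_sums.
Context {R : realType} {dO : measure_display} {Omega : measurableType dO} {d : nat}.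
Variables (P : probability Omega R) (beta : R).
Variable a : nat -> Omega -> 'rV[R]_d.

Lemma measurable_dsumv t : (forall k, (1 <= k <= t)%N -> measurable_vec (a k)) ->
  measurable_vec (fun o => dsumv beta (a ^~ o) t).
Proof.
elim: t => [_|t IH h].
  by under eq_fun do rewrite dsumv0; move=> i; exact: measurable_cst.
under eq_fun do rewrite dsumvS; apply: measurable_vecD; last by apply: h; rewrite leqnn.
apply: measurable_vecZ => //; apply: IH => k /andP[k1 kt]; apply: h.
by rewrite k1 leqW.
Qed.

Lemma L2_dsumv t : (forall k, (1 <= k <= t)%N -> L2 P (a k)) ->
  L2 P (fun o => dsumv beta (a ^~ o) t).
Proof.
elim: t => [_|t IH h].
  by under eq_fun do rewrite dsumv0; exact: L2_cst.
under eq_fun do rewrite dsumvS; apply: L2D; last by apply: h; rewrite leqnn.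
apply: L2Z => //; apply: IH => k /andP[k1 kt]; apply: h.
by rewrite k1 leqW.
Qed.

End discounted_random_sums.

(** Isolates the comparator, which meets the gradients only through their discounted sum. *)
Lemma regretE (R : realType) (d : nat) (Omega : Type) (beta mu : R)
    (g Delta : nat -> Omega -> 'rV[R]_d) t u o :
  regret beta mu g Delta t u o =
  dsum beta (fun k => loss mu (g k o) (Delta k o)) t
  - (vdot (dsumv beta (g ^~ o) t) u + mu / 2 * vnorm u ^+ 2 * dsum beta (fun=> 1) t).
Proof.
rewrite /regret /dsum /dsumv vdot_suml mulr_sumr -big_split -sumrB/=.
apply: eq_bigr => k _; rewrite /loss vdotZl mulr1; ring.
Qed.

(** * The run of the conversion scheme: integrability, adaptedness and noise *)

Section conversion.
Context {R : realType} {dO : measure_display} {Omega : measurableType dO} {d : nat}.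
Variables (P : probability Omega R) (F : 'rV[R]_d -> R) (G sigma : R) (T : nat).
Variables (Gf Hf : nat -> set (set Omega)).
Variables (x Delta g : nat -> Omega -> 'rV[R]_d) (s : nat -> Omega -> R).
Hypothesis dF : forall z, differentiable F z.
Hypothesis intF : forall z w, (\int[lebesgue_measure]_(t in `[0%R, 1%R]%classic)
  (vdot (grad F (w + t *: (z - w))) (z - w))%:E = (F z - F w)%:E)%E.
Hypothesis bF : forall z, vnorm (grad F z) <= G.
Hypothesis filt : forall t, (1 <= t <= T)%N ->
  [/\ sigma_algebra setT (Gf t), sigma_algebra setT (Hf t),
      Gf t `<=` measurable, Hf t `<=` measurable &
      (Gf t `<=` Hf t /\ Hf t `<=` Gf t.+1)].
Hypothesis adapted : forall t, (1 <= t <= T)%N ->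
  Gmeas_v (Gf t) (Delta t) /\ Gmeas_v (Gf t) (x t).
Hypothesis unif : forall t, (1 <= t <= T)%N ->
  Gmeas (Hf t) (s t) /\
  forall A B, Gf t A -> measurable B ->
    P (A `&` s t @^-1` B) = (P A * lebesgue_measure (B `&` `[0%R, 1%R]))%E.

Let y t o := x t o + s t o *: Delta t o.
Let gy t o := grad F (y t o).
Let noise t o := g t o - gy t o.

Hypothesis oracle : forall t, (1 <= t <= T)%N ->
  [/\ Gmeas_v (Gf t.+1) (g t),
      (forall i, P.-integrable setT (fun o => (g t o ord0 i)%:E)),
      (forall A i, Hf t A ->
         (\int[P]_(o in A) (g t o ord0 i)%:E =
          \int[P]_(o in A) (grad F (x t o + s t o *: Delta t o) ord0 i)%:E)%E) &
      (forall A, Hf t A ->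
         (\int[P]_(o in A)
            ((vnorm (g t o - grad F (x t o + s t o *: Delta t o))) ^+ 2)%:E
          <= (sigma ^+ 2)%:E * P A)%E)].
Hypothesis momentDelta : forall t, (1 <= t <= T)%N ->
  P.-integrable setT (fun o => ((vnorm (Delta t o)) ^+ 2)%:E).

Lemma measurable_run t : (1 <= t <= T)%N ->
  [/\ measurable_vec (x t), measurable_vec (Delta t), measurable_vec (y t),
      measurable_vec (gy t) & measurable_vec (g t)].
Proof.
move=> tT; have [sG sH subG subH _] := filt tT; have [GD Gx] := adapted tT.
have [Hs _] := unif tT; have [_ ig _ _] := oracle tT.
have mx := Gmeas_v_measurable subG Gx; have mD := Gmeas_v_measurable subG GD.
have my : measurable_vec (y t).
  by apply: measurable_vecD => //; apply: measurable_vecZ => //; exact: Gmeas_measurable Hs.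
split => //; first by move=> i; exact: measurable_grad_comp.
by move=> i; exact/measurable_EFinP/(measurable_int P (ig i)).
Qed.

Lemma L2_Delta t : (1 <= t <= T)%N -> L2 P (Delta t).
Proof.
move=> tT; have [_ mD _ _ _] := measurable_run tT; split => //.
apply: eq_integrable (momentDelta tT) => // o _.
by rewrite /= -sqr_vnorm.
Qed.

Lemma L2_gy t : (1 <= t <= T)%N -> L2 P (gy t).
Proof.
move=> tT; have [_ _ _ mgy _] := measurable_run tT.
by apply: (@L2_bounded _ _ _ _ _ _ G) => // o; exact: bF.
Qed.

(** The conditional variance bound is taken on the whole space; its finiteness also yields square
    integrability. *)
Lemma noise_moment t : (1 <= t <= T)%N ->
  L2 P (noise t) /\ Ex P (fun o => vdot (noise t o) (noise t o)) <= sigma ^+ 2.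
Proof.
move=> tT; have [_ _ _ mgy mg] := measurable_run tT.
have mn : measurable_vec (noise t) by exact: measurable_vecB.
have [_ [H0 HC _] _ _ _] := filt tT; have [_ _ _ /(_ setT)] := oracle tT.
have -> : (\int[P]_o ((vnorm (g t o - grad F (x t o + s t o *: Delta t o))) ^+ 2)%:E
   = \int[P]_o (vdot (noise t o) (noise t o))%:E)%E.
  by apply: eq_integral => o _; rewrite sqr_vnorm.
rewrite probability_setT mule1 => var.
have HT : Hf t setT by rewrite -(setD0 setT); exact: HC.
have {}var := var HT.
have Ln : L1 P (fun o => vdot (noise t o) (noise t o)).
  apply: L1_ge0P => [|o|]; [exact: measurable_vdot|exact: vdot_ge0|].
  by rewrite (le_lt_trans var)// ltry.
by split; [split|rewrite -lee_fin -ExE].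
Qed.

(** The oracle output is the sum of square-integrable noise and a bounded gradient. *)
Lemma L2_g t : (1 <= t <= T)%N -> L2 P (g t).
Proof.
move=> tT; have := L2D (noise_moment tT).1 (L2_gy tT).
by under eq_fun do rewrite subrK.
Qed.

Lemma integral_noise0 t A i : (1 <= t <= T)%N -> Hf t A ->
  (\int[P]_(o in A) (noise t o ord0 i)%:E = 0)%E.
Proof.
move=> tT HA; have [_ _ _ subH _] := filt tT; have [_ _ unb _] := oracle tT.
have mA := subH _ HA.
have iA (X : Omega -> 'rV[R]_d) : L2 P X ->
    P.-integrable A (EFin \o (fun o => X o ord0 i)).
  move=> LX; exact: (integrableS measurableT mA (@subsetT _ _) (L2_coord i LX)).
transitivity (\int[P]_(o in A) ((g t o ord0 i)%:E - (gy t o ord0 i)%:E))%E.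
  by apply: eq_integral => o _; rewrite -EFinB !mxE.
rewrite (integralB mA (iA _ (L2_g tT)) (iA _ (L2_gy tT))) /= unb// subee//.
exact: (integrable_fin_num mA (iA _ (L2_gy tT))).
Qed.

Lemma Gf_mono k t : (1 <= k <= t)%N -> (t <= T)%N -> Gf k `<=` Gf t.
Proof.
move=> /andP[k1]; elim: t => [|t IH]; first by rewrite leqn0 => /eqP k0; rewrite k0 in k1.
rewrite leq_eqVlt => /predU1P[-> _|kt tT]; first exact: subset_refl.
have tT' : (1 <= t <= T)%N by rewrite (leq_trans k1 kt) ltnW.
have [_ _ _ _ [GH HG]] := filt tT'.
by apply: subset_trans (IH kt (ltnW tT)) _; exact: subset_trans GH HG.
Qed.

(** All ingredients of the noise of round [k] are known in [Gf k.+1], which the chain of inclusions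
    places inside [Hf t.+1]. *)
Lemma Gmeas_noise k t : (1 <= k <= t)%N -> (t < T)%N -> Gmeas_v (Hf t.+1) (noise k).
Proof.
move=> kt tT; have tT' : (1 <= t.+1 <= T)%N by [].
have /andP[k1 ket] := kt.
have kT : (1 <= k <= T)%N by rewrite k1 (leq_trans ket)// ltnW.
have [_ sH _ subH [GH _]] := filt tT'.
have [_ _ _ _ [GHk HGk]] := filt kT.
have sub : Gf k.+1 `<=` Hf t.+1.
  by apply: subset_trans GH; exact: Gf_mono.
have [GD Gx] := adapted kT; have [Hs _] := unif kT; have [Gg _ _ _] := oracle kT.
have up (X : Omega -> 'rV[R]_d) : Gmeas_v (Gf k.+1) X ->
    measurable_vec (X : g_sigma_algebraType (Hf t.+1) -> 'rV[R]_d).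
  by move=> GX i; apply/(GmeasE sH) => B mB; exact/sub/GX.
have upk (X : Omega -> 'rV[R]_d) : Gmeas_v (Gf k) X ->
    measurable_vec (X : g_sigma_algebraType (Hf t.+1) -> 'rV[R]_d).
  by move=> GX; apply: up => i B mB; exact/HGk/GHk/GX.
move=> i; apply/(GmeasE sH); move: i.
apply: measurable_vecB; first exact: up.
move=> i; apply: measurable_grad_comp => //; apply: measurable_vecD; first exact: upk.
apply: measurable_vecZ; last exact: upk.
by apply/(GmeasE sH) => B mB; exact/sub/HGk/Hs.
Qed.

Variable beta : R.
Hypotheses (b0 : 0 < beta) (b1 : beta < 1).

Let N t o := dsumv beta (noise ^~ o) t.

Lemma L2_N t : (t <= T)%N -> L2 P (N t).
Proof.
move=> tT; apply: L2_dsumv => k /andP[k1 kt].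
by apply: (noise_moment _).1; rewrite k1 (leq_trans kt).
Qed.

(* The cross term [E <N t, noise t.+1>] vanishes since [N t] is known before
   the oracle call of round [t.+1]. *)
Lemma N_moment t : (t <= T)%N ->
  Ex P (fun o => vdot (N t o) (N t o)) <= sigma ^+ 2 / (1 - beta).
Proof.
elim: t => [_|t IH tT].
  have -> : (fun o => vdot (N 0 o) (N 0 o)) = (fun=> 0).
    by apply/funext => o; rewrite /N dsumv0 vdot0l.
  by rewrite Ex_cst divr_ge0 ?sqr_ge0// subr_ge0 ltW.
have tT' : (1 <= t.+1 <= T)%N by [].
have [sG sH subG subH _] := filt tT'.
have [Ln var] := noise_moment tT'; have LN := L2_N (ltnW tT).
have GN : Gmeas_v (Hf t.+1) (N t).
  move=> i; apply/(GmeasE sH); move: i; apply: measurable_dsumv => k kt i.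
  by apply/(GmeasE sH); exact: (Gmeas_noise kt tT).
have cross : Ex P (fun o => vdot (N t o) (noise t.+1 o)) = 0.
  by apply: (Ex_vdot_pull_out0 sH subH) => // A i; exact: integral_noise0.
have -> : (fun o => vdot (N t.+1 o) (N t.+1 o)) = (fun o =>
    (beta ^+ 2 * vdot (N t o) (N t o) + 2 * beta * vdot (N t o) (noise t.+1 o))
    + vdot (noise t.+1 o) (noise t.+1 o)).
  apply/funext => o; rewrite /N dsumvS; move: (dsumv _ _ _) (noise _ _) => u v.
  rewrite vdotDl !vdotDr !vdotZl !vdotZr (vdotC v u); ring.
have L1N : L1 P (fun o => beta ^+ 2 * vdot (N t o) (N t o)) by exact/L1Z/LN.2.
have L1c : L1 P (fun o => 2 * beta * vdot (N t o) (noise t.+1 o)).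
  by apply: L1Z; exact: L1_vdot.
rewrite (ExD (L1D L1N L1c) Ln.2) (ExD L1N L1c) (ExZ _ LN.2).
rewrite (ExZ _ (L1_vdot LN Ln)) cross mulr0 addr0.
have {}IH := IH (ltnW tT).
have b2 : 0 <= beta ^+ 2 by rewrite sqr_ge0.
apply: le_trans (lerD (ler_wpM2l b2 IH) var) _.
(* The induction closes with slack [beta * sigma^2]. *)
rewrite -subr_ge0.
have -> : sigma ^+ 2 / (1 - beta) - (beta ^+ 2 * (sigma ^+ 2 / (1 - beta)) + sigma ^+ 2)
   = beta * sigma ^+ 2.
  by field; rewrite subr_eq0 gt_eqF.
by rewrite mulr_ge0 ?sqr_ge0// ltW.
Qed.

(** * From discounted regret to the weighted norms of the gradient sums *)

Section regret_bound.
(** [D] is the comparator radius; by [sa] and [N_moment], [a] bounds the root mean square of the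
    accumulated noise. *)
Variables (mu D a : R).
Hypotheses (mu0 : 0 <= mu) (D0 : 0 < D) (a0 : 0 < a) (Gs0 : 0 <= G + sigma).
Hypothesis sa : sigma ^+ 2 / (1 - beta) <= a ^+ 2.
Hypothesis Hreg : forall t, (1 <= t <= T)%N -> forall u : Omega -> 'rV[R]_d,
  (forall i, measurable_fun setT (fun o => u o ord0 i)) ->
  (\int[P]_o (regret beta mu g Delta t (u o) o)%:E
   <= \int[P]_o (2 * vnorm (u o) * (G + sigma) / (beta * Num.sqrt (1 - beta))
                 + mu / 2 * vnorm (u o) ^+ 2)%:E)%E.

Let S t o := dsumv beta (gy ^~ o) t.
(** Built from the true gradients, not from the oracle outputs. Where [S t o] vanishes, division by
    zero returns 0 and so does [u]. *)
Let u t o := (- (D / vnorm (S t o))) *: S t o.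
Let K := (G + sigma) / (beta * Num.sqrt (1 - beta)).

Lemma L2_S t : (t <= T)%N -> L2 P (S t).
Proof.
move=> tT; apply: L2_dsumv => k /andP[k1 kt].
by apply: L2_gy; rewrite k1 (leq_trans kt).
Qed.

Lemma L1_vnorm (X : Omega -> 'rV[R]_d) : L2 P X -> L1 P (fun o => vnorm (X o)).
Proof.
move=> LX; apply: (@L1_le _ _ _ _ _ _ _ (L1D (L1_cst P 1) LX.2)).
  exact: measurable_vnorm LX.1.
move=> o; rewrite ger0_norm ?vnorm_ge0// -sqr_vnorm.
have := sqr_ge0 (vnorm (X o) - 1); have := vnorm_ge0 (X o).
by rewrite sqrrB1; lra.
Qed.

Lemma vnorm_u_le t o : vnorm (u t o) <= D.
Proof.
rewrite vnormZ normrN ger0_norm ?divr_ge0 ?vnorm_ge0 ?(ltW D0)//.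
have [->|S0] := eqVneq (vnorm (S t o)) 0; first by rewrite mulr0 ltW.
by rewrite divfK.
Qed.

Lemma vdot_S_u t o : vdot (S t o) (u t o) = - (D * vnorm (S t o)).
Proof.
rewrite vdotZr -sqr_vnorm.
have [->|S0] := eqVneq (vnorm (S t o)) 0; first by rewrite expr0n/= !mulr0 oppr0.
by rewrite mulNr expr2 mulrA divfK.
Qed.

Lemma L2_u t : (t <= T)%N -> L2 P (u t).
Proof.
move=> tT; apply: (@L2_bounded _ _ _ _ _ _ D); last exact: vnorm_u_le.
apply: measurable_vecZ; last exact: (L2_S tT).1.
apply: measurableT_comp => //; apply: measurable_funM => //.
have mS := measurable_vnorm (L2_S tT).1.
exact: (measurableT_comp (@measurable_inv R) mS).
Qed.

Let ell t o := loss mu (g t o) (Delta t o).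

Lemma L1_loss t : (1 <= t <= T)%N -> L1 P (ell t).
Proof.
move=> tT; apply: L1D; first exact: L1_vdot (L2_g tT) (L2_Delta tT).
by apply: L1Z; exact: momentDelta.
Qed.

Lemma L1_dsum (f : nat -> Omega -> R) t :
  (forall k, (1 <= k <= t)%N -> L1 P (f k)) -> L1 P (fun o => dsum beta (f ^~ o) t).
Proof.
move=> Lf; apply: L1_sum => k; rewrite mem_index_iota ltnS => kt.
by apply: L1Z; exact: Lf.
Qed.

(** At the comparator [u t], the regret is the discounted loss plus [D |S_t|], minus [<N_t, u_t>]
    and the comparator's own regularisation. On the right, the first two terms are the regret
    guarantee, [D * a] pays for the noise, and the last term bounds that regularisation. *)
Lemma round_bound t : (1 <= t <= T)%N ->
  D * Ex P (fun o => vnorm (S t o)) + Ex P (fun o => dsum beta (ell ^~ o) t) <=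
  2 * D * K + mu / 2 * D ^+ 2 + D * a + mu / 2 * D ^+ 2 * dsum beta (fun=> 1) t.
Proof.
move=> tT; have /andP[t1 tT'] := tT.
have LS := L2_S tT'; have Lu := L2_u tT'; have LN := L2_N tT'.
have Ll : L1 P (fun o => dsum beta (ell ^~ o) t).
  apply: L1_dsum => k /andP[k1 kt]; apply: L1_loss.
  by rewrite k1 (leq_trans kt).
have Lu2 : L1 P (fun o => vnorm (u t o) ^+ 2).
  by under [f in L1 P f]eq_fun do rewrite sqr_vnorm; exact: Lu.2.
have LG : L2 P (fun o => dsumv beta (g ^~ o) t).
  by apply: L2_dsumv => k /andP[k1 kt]; apply: L2_g; rewrite k1 (leq_trans kt).
have GSN o : dsumv beta (g ^~ o) t = S t o + N t o.
  rewrite -dsumvD; apply: eq_bigr => k _; congr (_ *: _).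
  by rewrite addrC subrK.
have Lreg : L1 P (fun o => regret beta mu g Delta t (u t o) o).
  under [f in L1 P f]eq_fun do rewrite regretE.
  apply: L1B => //; apply: L1D; first exact: L1_vdot.
  under [f in L1 P f]eq_fun do rewrite mulrAC.
  exact: L1Z.
have LB : L1 P (fun o => 2 * vnorm (u t o) * (G + sigma) / (beta * Num.sqrt (1 - beta))
                 + mu / 2 * vnorm (u t o) ^+ 2).
  apply: L1D; last exact: L1Z.
  under [f in L1 P f]eq_fun do rewrite -mulrA (mulrC 2) -mulrA mulrC.
  exact/L1Z/L1_vnorm.
have K0 : 0 <= K.
  by rewrite divr_ge0// mulr_ge0 ?sqrtr_ge0// ltW.
have Ereg : Ex P (fun o => regret beta mu g Delta t (u t o) o) <=
    2 * D * K + mu / 2 * D ^+ 2.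
  have := Hreg tT Lu.1; rewrite (ExE Lreg) (ExE LB) lee_fin => /le_trans; apply.
  rewrite -[leRHS](Ex_cst P); apply: le_Ex => //; first exact: L1_cst.
  move=> o; have uD := vnorm_u_le t o; have un := vnorm_ge0 (u t o).
  rewrite -mulrA; apply: lerD; first by rewrite ler_wpM2r// ler_pM2l.
  by rewrite ler_wpM2l ?divr_ge0// lerXn2r// nnegrE// ltW.
have LN2 : L1 P (fun o => D / 2 * (a + a^-1 * vdot (N t o) (N t o))).
  by apply: L1Z; apply: L1D; [exact: L1_cst|exact/L1Z/LN.2].
(* Since [E |N|^2 <= a^2], each of the two summands contributes at most [D * a / 2]. *)
have EN : Ex P (fun o => D / 2 * (a + a^-1 * vdot (N t o) (N t o))) <= D * a.
  rewrite ExZ; last by apply: L1D; [exact: L1_cst|exact/L1Z/LN.2].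
  rewrite ExD; [|exact: L1_cst|exact/L1Z/LN.2].
  rewrite Ex_cst ExZ; last exact: LN.2.
  have h := le_trans (N_moment tT') sa.
  have : a^-1 * Ex P (fun o => vdot (N t o) (N t o)) <= a.
    by rewrite ler_pdivrMl// -expr2.
  by rewrite -mulrA ler_pM2l//; lra.
set w := mu / 2 * D ^+ 2 * dsum beta (fun=> 1) t.
have w1 : 0 <= dsum beta (fun=> 1) t by exact: dsum_ge0.
have pw o : D * vnorm (S t o) + dsum beta (ell ^~ o) t <=
    regret beta mu g Delta t (u t o) o
    + D / 2 * (a + a^-1 * vdot (N t o) (N t o)) + w.
  rewrite regretE GSN vdotDl vdot_S_u -/(ell _ _).
  have uD := vnorm_u_le t o; have un := vnorm_ge0 (u t o).
  have Nn := vnorm_ge0 (N t o).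
  have hN : vdot (N t o) (u t o) <= D / 2 * (a + a^-1 * vdot (N t o) (N t o)).
    apply: le_trans (ler_norm _) (le_trans (vdot_le_vnormM _ _) _).
    apply: (@le_trans _ _ (vnorm (N t o) * D)); first by rewrite ler_wpM2l.
    (* AM-GM: [2 |N| <= a + |N|^2 / a]. *)
    rewrite -sqr_vnorm mulrC -mulrA ler_pM2l//.
    rewrite -subr_ge0; have := sqr_ge0 (vnorm (N t o) - a).
    have i2 : 0 <= (2 * a)^-1 by rewrite invr_ge0 mulr_ge0// ltW.
    move=> /(mulr_ge0 i2); congr (_ <= _).
    by field; rewrite gt_eqF.
  have hu : mu / 2 * vnorm (u t o) ^+ 2 * dsum beta (fun=> 1) t <= w.
    by rewrite ler_wpM2r// ler_wpM2l ?divr_ge0// lerXn2r// nnegrE// ltW.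
  by lra.
have LSn := L1_vnorm LS.
have := le_Ex (L1D (L1Z D LSn) Ll) (L1D (L1D Lreg LN2) (L1_cst P w)) pw.
rewrite (ExD (L1Z D LSn) Ll) (ExZ _ LSn) (ExD (L1D Lreg LN2) (L1_cst P w)).
rewrite (ExD Lreg LN2) Ex_cst; lra.
Qed.

Let W := \sum_(1 <= t < T.+1) weight beta T t.

(** [Delta t] is known before the oracle call, so the noise is orthogonal to it in expectation. The
    true gradient remains, and [expected_increment] evaluates it. *)
Lemma L1_decrease t : (1 <= t <= T)%N ->
  L1 P (fun o => F (x t o) - F (x t o + Delta t o)) /\
  Ex P (fun o => F (x t o) - F (x t o + Delta t o)) =
  - Ex P (fun o => vdot (g t o) (Delta t o)).
Proof.
move=> tT; have [sG sH subG subH [GH _]] := filt tT; have [GD Gx] := adapted tT.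
have [Hs ind] := unif tT.
have [LI EI] := expected_increment dF intF bF sG subG Gx GD (L2_Delta tT)
  (Gmeas_measurable subH Hs) ind.
have oE : (fun o => F (x t o) - F (x t o + Delta t o)) =
    (fun o => -1 * (F (x t o + Delta t o) - F (x t o))).
  by apply/funext => o; rewrite mulN1r opprB.
split; first by rewrite oE; exact: L1Z.
rewrite oE ExZ// mulN1r -EI; congr (- _).
have Ln := (noise_moment tT).1.
have cross : Ex P (fun o => vdot (Delta t o) (noise t o)) = 0.
  apply: (Ex_vdot_pull_out0 sH subH) => //.
  - by move=> i B mB; exact/GH/GD.
  - exact: L2_Delta.
  - by move=> A i; exact: integral_noise0.
rewrite -[LHS]addr0 -cross -ExD; first last.
- exact: L1_vdot (L2_Delta tT) Ln.
- exact: L1_vdot (L2_gy tT) (L2_Delta tT).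
congr (Ex P _); apply/funext => o.
by rewrite (vdotC (Delta t o)) -vdotDl addrC subrK.
Qed.

(** The weighted sum of [round_bound]. By [weight_dsum] the discounted losses become plain ones,
    which [L1_decrease] evaluates, and the factors [dsum beta (fun=> 1) t] add up to [T]. *)
Lemma weighted_gradient_bound :
  D * \sum_(1 <= t < T.+1) weight beta T t * Ex P (fun o => vnorm (S t o)) <=
  W * (2 * D * K + mu / 2 * D ^+ 2 + D * a) + mu / 2 * D ^+ 2 * T%:R
  + Ex P (fun o => \sum_(1 <= t < T.+1) (F (x t o) - F (x t o + Delta t o)))
  - mu / 2 * Ex P (fun o => \sum_(1 <= t < T.+1) vnorm (Delta t o) ^+ 2).
Proof.
have rng t : t \in index_iota 1 T.+1 -> (1 <= t <= T)%N.
  by rewrite mem_index_iota ltnS.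
have EL : \sum_(1 <= t < T.+1) weight beta T t * Ex P (fun o => dsum beta (ell ^~ o) t) =
    - Ex P (fun o => \sum_(1 <= t < T.+1) (F (x t o) - F (x t o + Delta t o)))
    + mu / 2 * Ex P (fun o => \sum_(1 <= t < T.+1) vnorm (Delta t o) ^+ 2).
  have Ld t : (1 <= t <= T)%N -> L1 P (fun o => dsum beta (ell ^~ o) t).
    move=> /andP[_ tT]; apply: L1_dsum => k /andP[k1 kt]; apply: L1_loss.
    by rewrite k1 (leq_trans kt).
  transitivity (Ex P (fun o => \sum_(1 <= t < T.+1) ell t o)).
    under [f in _ = Ex P f]eq_fun do rewrite -(weight_dsum beta).
    rewrite Ex_sum; last by move=> t /rng tT; exact/L1Z/Ld.
    by rewrite big_seq [RHS]big_seq; apply: eq_bigr => t /rng tT; rewrite ExZ//; exact: Ld.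
  rewrite !Ex_sum; first last.
  - by move=> t /rng; exact: L1_loss.
  - by move=> t /rng tT; exact: (L1_decrease tT).1.
  - by move=> t /rng; exact: momentDelta.
  rewrite mulr_sumr -sumrN -big_split [LHS]big_seq [RHS]big_seq; apply: eq_bigr => t /rng tT /=.
  rewrite /ell /loss ExD; [|exact: L1_vdot (L2_g tT) (L2_Delta tT)|
    by apply: L1Z; exact: momentDelta].
  by rewrite ExZ; [rewrite (L1_decrease tT).2 opprK|exact: momentDelta].
have : \sum_(1 <= t < T.+1) weight beta T t *
    (D * Ex P (fun o => vnorm (S t o)) + Ex P (fun o => dsum beta (ell ^~ o) t)) <=
    \sum_(1 <= t < T.+1) weight beta T t *
    (2 * D * K + mu / 2 * D ^+ 2 + D * a + mu / 2 * D ^+ 2 * dsum beta (fun=> 1) t).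
  rewrite big_seq [leRHS]big_seq; apply: ler_sum => t /rng tT.
  by rewrite ler_wpM2l ?weight_ge0//; exact: round_bound.
under eq_bigr do rewrite mulrDr mulrCA.
under [leRHS]eq_bigr do rewrite mulrDr [X in _ + X]mulrCA.
rewrite !big_split/= -!mulr_sumr -mulr_suml weight_dsum EL sumr_const_nat subSS subn0.
by rewrite /W; lra.
Qed.

End regret_bound.

(** * Expected spread and the bound on the expected [lam_norm] *)

Section spread_bound.
Variable C : R.
Hypothesis mx0 : measurable_vec (x 0%N).
Hypothesis Cineq :
  (\int[P]_o (\sum_(1 <= t < T.+1) (vnorm (x t o - x t.-1 o)) ^+ 2)%:E
   <= C%:E * \int[P]_o (\sum_(1 <= t < T.+1) (vnorm (Delta t o)) ^+ 2)%:E)%E.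

Let Vs t o := spread beta (x ^~ o) (y ^~ o) t.
Let dx2 o := \sum_(1 <= t < T.+1) vnorm (x t o - x t.-1 o) ^+ 2.
Let Delta2 o := \sum_(1 <= t < T.+1) vnorm (Delta t o) ^+ 2.

Lemma measurable_x t : (t <= T)%N -> measurable_vec (x t).
Proof. by case: t => [//|t] tT; have [] := measurable_run (t := t.+1) tT. Qed.

Lemma L1_Delta2 : L1 P Delta2.
Proof.
by apply: L1_sum => t; rewrite mem_index_iota ltnS => tT; exact: momentDelta.
Qed.

Lemma measurable_spread t : (t <= T)%N -> measurable_fun setT (Vs t).
Proof.
move=> tT; rewrite /Vs /spread /dsum.
have mk k : (1 <= k <= t)%N ->
    measurable_fun setT (fun o => beta ^+ (t - k) * vnorm (y k o - x t o) ^+ 2).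
  move=> /andP[k1 kt]; apply: measurable_funM => //; apply: measurable_funX.
  have [_ _ my _ _] := measurable_run (t := k) ltac:(by rewrite k1 (leq_trans kt)).
  by apply: measurable_vnorm; apply: measurable_vecB => //; exact: measurable_x.
apply: measurable_sum_in => k; rewrite mem_index_iota ltnS; exact: mk.
Qed.

(** Only the law of [s t] is given, so it may leave the unit interval on a null set; countably many
    such sets are discarded together. *)
Lemma s01_ae : {ae P, forall o t, (1 <= t <= T)%N -> `|s t o| <= 1}.
Proof.
apply: ae_foralln => t.
have [tT|tT] := boolP (1 <= t <= T)%N; last by apply: aeW => o.
have [[G0 GC _] _ _ subH _] := filt tT; have [Hs ind] := unif tT.
have mI : measurable (~` `[0, 1]%classic : set R) by exact: measurableC.
exists (s t @^-1` (~` `[0, 1])); split.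
- exact/subH/Hs.
- have GT : Gf t setT by rewrite -(setD0 setT); exact: GC.
  by have := ind _ _ GT mI; rewrite setTI setICl measure0 mule0.
- move=> o /=; apply: contra_not; rewrite in_itv/= => /andP[s0 s1] _.
  by rewrite ger0_norm.
Qed.

(** Almost surely [|y_t - x_t| = |s_t| |Delta_t| <= |Delta_t|], while [Cineq] controls the movement
    of the iterates. Its finite right-hand side also makes that movement integrable. *)
Lemma spread_moment :
  L1 P (fun o => \sum_(1 <= t < T.+1) weight beta T t * Vs t o) /\
  Ex P (fun o => \sum_(1 <= t < T.+1) weight beta T t * Vs t o) <=
  (4 / (1 - beta) ^+ 2 * C + 2) * Ex P Delta2.
Proof.
have rng t : t \in index_iota 1 T.+1 -> (1 <= t <= T)%N.
  by rewrite mem_index_iota ltnS.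
have mdx : measurable_fun setT dx2.
  apply: measurable_sum_in => t /rng /andP[t1 tT].
  apply: measurable_funX; apply: measurable_vnorm; apply: measurable_vecB.
    exact: measurable_x.
  by apply: measurable_x; rewrite (leq_trans (leq_pred t)).
have dx0 o : 0 <= dx2 o by apply: sumr_ge0 => t _; rewrite sqr_ge0.
have Delta0 o : 0 <= Delta2 o by apply: sumr_ge0 => t _; rewrite sqr_ge0.
have Cineq' : (\int[P]_o (dx2 o)%:E <= (C * Ex P Delta2)%:E)%E.
  by rewrite EFinM -(ExE L1_Delta2).
have Ldx : L1 P dx2.
  by apply: L1_ge0P => //; rewrite (le_lt_trans Cineq')// ltry.
set M := fun o => \sum_(1 <= t < T.+1) _.
have mM : measurable_fun setT M.
  apply: measurable_sum_in => t /rng /andP[t1 tT].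
  by apply: measurable_funM => //; exact: measurable_spread.
have M0 o : 0 <= M o.
  by apply: sumr_ge0 => t _; rewrite mulr_ge0 ?weight_ge0// spread_ge0.
pose B o := 4 / (1 - beta) ^+ 2 * dx2 o + 2 * Delta2 o.
have LB : L1 P B by apply: L1D; apply: L1Z => //; exact: L1_Delta2.
have c0 : 0 <= 4 / (1 - beta) ^+ 2 by rewrite divr_ge0 ?sqr_ge0.
have MB : (\int[P]_o (M o)%:E <= \int[P]_o (B o)%:E)%E.
  apply: ae_ge0_le_integral => //.
  - by move=> o _; rewrite lee_fin.
  - exact/measurable_EFinP.
  - by move=> o _; rewrite lee_fin addr_ge0// mulr_ge0.
  - by apply: measurable_int LB.
  - have := s01_ae; apply: filterS => o so _; rewrite lee_fin.
    apply: le_trans (sum_weight_spread_le _ _ b0 b1 _) _.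
    rewrite lerD2l ler_pM2l// big_seq [leRHS]big_seq; apply: ler_sum => t /rng tT.
    rewrite /y addrC addKr vnormZ exprMn ler_piMl ?sqr_ge0//.
    by rewrite expr_le1// so.
have LM : L1 P M.
  by apply: L1_ge0P => //; rewrite (le_lt_trans MB)// (ExE LB) ltry.
split => //.
rewrite -lee_fin -(ExE LM); apply: le_trans MB _; rewrite (ExE LB) lee_fin.
rewrite ExD; [|exact: L1Z|exact/L1Z/L1_Delta2].
rewrite (ExZ _ Ldx) (ExZ _ L1_Delta2) [leRHS]mulrDl lerD2r -[leRHS]mulrA ler_wpM2l//.
by rewrite -lee_fin -(ExE Ldx).
Qed.

Let S t o := dsumv beta (gy ^~ o) t.

(** Applies [lam_norm_ema_le] with centre [x_t] in each round and averages over [tau]; the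
    normalisation [r] then cancels against [tau_probE]. *)
Lemma integral_lam_norm_le (lam : R) : 0 <= lam -> (0 < T)%N ->
  (\sum_(1 <= t < T.+1)
      (tau_prob beta T t)%:E * \int[P]_o lam_norm F lam (ema beta y t o)
   <= (T%:R^-1 *
     (\sum_(1 <= t < T.+1) weight beta T t * Ex P (fun o => vnorm (S t o))
     + lam * Ex P (fun o => \sum_(1 <= t < T.+1) weight beta T t * Vs t o)))%:E)%E.
Proof.
move=> lam0 T0.
have rng t : t \in index_iota 1 T.+1 -> (1 <= t <= T)%N.
  by rewrite mem_index_iota ltnS.
have wp t : 0 < weight beta T t.
  by rewrite /weight; case: ifP => // _; rewrite subr_gt0.
have [LM _] := spread_moment.
have LV t : (1 <= t <= T)%N -> L1 P (Vs t).
  (* All summands are nonnegative and the weights positive, so each spread is dominated by the whole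
     sum divided by its own weight. *)
  move=> tT; apply: (@L1_le _ _ _ _ _ _ _ (L1Z (weight beta T t)^-1 LM)).
    by apply: measurable_spread; case/andP: tT.
  move=> o; rewrite ger0_norm ?spread_ge0// -ler_pdivrMl ?invr_gt0// invrK.
  rewrite (bigD1_seq t) ?iota_uniq ?mem_index_iota//= lerDl.
  by apply: sumr_ge0 => k _; rewrite mulr_ge0 ?weight_ge0// spread_ge0.
have LS t : (1 <= t <= T)%N -> L1 P (fun o => vnorm (S t o)).
  by move=> /andP[_ tT]; exact/L1_vnorm/L2_S.
rewrite Ex_sum; last by move=> t /rng tT; exact/L1Z/LV.
rewrite mulrDr !mulr_sumr -big_split/= -sumEFin big_seq [leRHS]big_seq.
apply: lee_sum => t /rng tT; have /andP[t1 tT'] := tT.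
pose r := (1 - beta) / (1 - beta ^+ t).
have bt : 0 < 1 - beta ^+ t by rewrite subr_gt0 expr_lt1.
have b1' : 0 < 1 - beta by rewrite subr_gt0.
have Lb : L1 P (fun o => r * (vnorm (S t o) + lam * Vs t o)).
  by apply: L1Z; apply: L1D; [exact: LS|exact/L1Z/LV].
have h : (\int[P]_o lam_norm F lam (ema beta y t o) <=
    (r * (Ex P (fun o => vnorm (S t o)) + lam * Ex P (Vs t)))%:E)%E.
  apply: le_trans (_ : _ <= \int[P]_o (r * (vnorm (S t o) + lam * Vs t o))%:E)%E _.
    (* [lam_norm] along the run is an infimum over a large family of laws, so this comparison rests
       on nonnegativity instead of measurability. *)
    apply: ge0_integral_mono => o; first exact: lam_norm_ge0.
    exact: lam_norm_ema_le.
  rewrite (ExE Lb) ExZ; last by apply: L1D; [exact: LS|exact/L1Z/LV].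
  by rewrite ExD ?ExZ//; [exact: LV|exact: LS|exact/L1Z/LV].
have tau0 : (0 <= (tau_prob beta T t)%:E)%E.
  rewrite lee_fin tau_probE// mulr_ge0 ?invr_ge0// mulr_ge0 ?weight_ge0//.
  by rewrite divr_ge0 ?ltW.
apply: le_trans (lee_wpmul2l tau0 h) _; rewrite -EFinM lee_fin tau_probE//.
rewrite ExZ; last exact: LV.
rewrite le_eqVlt; apply/orP; left; apply/eqP; rewrite /r; field.
by rewrite pnatr_eq0 -lt0n T0 !gt_eqF.
Qed.

End spread_bound.

End conversion.

(** * The choice of the parameters and the resulting constants *)

Section parameters.
Context {R : realType}.
Variables (G sigma lam eps C : R).
Hypotheses (lam0 : 0 < lam) (eps0 : 0 < eps).
Hypotheses (epsG : eps <= 7 / 2 * (G + sigma)) (C0 : 0 <= C).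

(** This is the square root of [1 - beta_star], the quantity in which the error terms are
    expressed. *)
Let e := eps / (7 * (G + sigma)).
Let kappa := kappa_star G sigma eps C.
Let mu := mu_star lam G sigma eps C.
Let D := D_star lam G sigma eps C.

Lemma Gsigma_gt0 : 0 < G + sigma.
Proof. by have := lt_le_trans eps0 epsG; lra. Qed.

Lemma step_gt0 : 0 < e.
Proof. by rewrite divr_gt0 ?mulr_gt0 ?Gsigma_gt0. Qed.

Lemma step_le_half : e <= 2^-1.
Proof.
have GS := Gsigma_gt0; rewrite ler_pdivrMr ?mulr_gt0//.
by apply: le_trans epsG _; lra.
Qed.

Lemma eps_step : eps = 7 * (e * (G + sigma)).
Proof. by rewrite /e; field; rewrite gt_eqF ?Gsigma_gt0. Qed.

(** Identifies the factor found both in [kappa_star] and in the lower bound on [T] as the effective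
    horizon [1 / (1 - beta)]. *)
Lemma horizonE : 49 * (G + sigma) ^+ 2 / eps ^+ 2 = (e ^+ 2)^-1.
Proof. by rewrite /e; field; rewrite !gt_eqF ?Gsigma_gt0. Qed.

Lemma beta_starE : 1 - beta_star G sigma eps = e ^+ 2.
Proof. by rewrite /beta_star opprB addrC subrK. Qed.

Lemma sqr_step_le : e ^+ 2 <= 4^-1.
Proof.
have -> : 4^-1 = (2^-1) ^+ 2 :> R by field.
by rewrite lerXn2r ?nnegrE ?invr_ge0 ?step_le_half// ltW ?step_gt0.
Qed.

Lemma kappa_ge1 : 1 <= kappa.
Proof.
by rewrite /kappa /kappa_star lerDl mulr_ge0 ?sqrtr_ge0// horizonE invr_ge0 sqr_ge0.
Qed.

(** With [q] the square root of [C] divided by [1 - beta], this reads [4 q^2 + 2 <= 4 (1 + q)^2]. *)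
Lemma kappa_sqr_ge : 4 / (1 - beta_star G sigma eps) ^+ 2 * C + 2 <= 4 * kappa ^+ 2.
Proof.
rewrite beta_starE /kappa /kappa_star horizonE; set q := (e ^+ 2)^-1 * Num.sqrt C.
have q0 : 0 <= q by rewrite mulr_ge0 ?sqrtr_ge0// invr_ge0 sqr_ge0.
have -> : 4 / (e ^+ 2) ^+ 2 * C = 4 * q ^+ 2.
  by rewrite [q ^+ 2]exprMn sqr_sqrtr// exprVn mulrA.
by rewrite sqrrD expr1n mul1r; nra.
Qed.

Lemma D_star_gt0 : 0 < D.
Proof.
have k0 : 0 < kappa := lt_le_trans ltr01 kappa_ge1.
by rewrite /D /D_star -/kappa !mulr_gt0 ?invr_gt0 ?sqrtr_gt0.
Qed.

Lemma mu_star_ge0 : 0 <= mu.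
Proof.
have k0 : 0 < kappa := lt_le_trans ltr01 kappa_ge1.
by rewrite /mu /mu_star -/kappa ltW// !mulr_gt0 ?sqrtr_gt0.
Qed.

(** First balance condition: the comparator's regularisation [mu/2 D^2] becomes [D * eps / 4]. *)
Lemma mu_D_star : mu * D = eps / 2.
Proof.
have k0 : kappa != 0 by rewrite gt_eqF// (lt_le_trans ltr01 kappa_ge1).
have l0 : Num.sqrt lam != 0 by rewrite gt_eqF// sqrtr_gt0.
rewrite /mu /D /mu_star /D_star -/kappa -[in RHS](sqr_sqrtr (ltW eps0)).
by field; rewrite k0 l0.
Qed.

(** Second balance condition: the regularisation of the played [Delta_t] is exactly strong enough to
    absorb [lam] times the spread, via [kappa_sqr_ge]. *)
Lemma mu_starE : mu / 2 = D * (lam * (4 * kappa ^+ 2)).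
Proof.
have k0 : kappa != 0 by rewrite gt_eqF// (lt_le_trans ltr01 kappa_ge1).
have l0 : Num.sqrt lam != 0 by rewrite gt_eqF// sqrtr_gt0.
rewrite /mu /D /mu_star /D_star -/kappa -[X in _ = _ * (X * _)](sqr_sqrtr (ltW lam0)).
by field; rewrite k0 l0.
Qed.

(** With [c = (G + sigma) / e], the bound [beta >= 3/4] reduces the regret and noise terms to
    [11/3 c D]. As [W <= 2 e^2 t] and [e^2 c = eps / 7], everything becomes a multiple of
    [eps * D * t]. *)
Lemma error_terms_le (W t : R) (beta := beta_star G sigma eps) :
  0 <= t -> W <= (1 - beta) * (1 + beta) * t ->
  W * (2 * D * ((G + sigma) / (beta * Num.sqrt (1 - beta))) + mu / 2 * D ^+ 2
       + D * ((G + sigma) / e)) + mu / 2 * D ^+ 2 * t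
  <= 3 * eps * (D * t).
Proof.
move=> t0 Wt; have D0 := D_star_gt0; have e0 := step_gt0; have GS := Gsigma_gt0.
have e2 := sqr_step_le; have bE : 1 - beta = e ^+ 2 := beta_starE.
have bge : 3 / 4 <= beta by lra.
have -> : mu / 2 * D ^+ 2 = D * (eps / 4).
  have -> : mu / 2 * D ^+ 2 = mu * D * (D / 2) by field.
  by rewrite mu_D_star; field.
rewrite bE in Wt; rewrite bE sqrtr_sqr (ger0_norm (ltW e0)).
set c := (G + sigma) / e.
have c0 : 0 < c by rewrite divr_gt0.
have -> : (G + sigma) / (beta * e) = c / beta.
  by rewrite /c; field; rewrite !gt_eqF//; lra.
have cb : c / beta <= 4 / 3 * c.
  by rewrite ler_pdivrMr; nra.
have ec : e ^+ 2 * c = eps / 7.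
  by rewrite [in RHS]eps_step /c; field; rewrite gt_eqF.
have W2 : W <= 2 * e ^+ 2 * t.
  apply: le_trans Wt _; rewrite ler_wpM2r// mulrC ler_wpM2r ?sqr_ge0//.
  by have := sqr_ge0 e; lra.
have B : 2 * D * (c / beta) + D * (eps / 4) + D * c <= D * (11 / 3 * c + eps / 4).
  by have := ler_wpM2l (ltW D0) cb; lra.
have nn : 0 <= 2 * D * (c / beta) + D * (eps / 4) + D * c.
  have cb0 : 0 <= c / beta by rewrite divr_ge0 ?(ltW c0)//; lra.
  have D0' := ltW D0; have c0' := ltW c0; have eps0' := ltW eps0.
  have e4 : 0 <= eps / 4 by rewrite divr_ge0.
  by have := mulr_ge0 D0' cb0; have := mulr_ge0 D0' e4; have := mulr_ge0 D0' c0'; lra.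
have Dt : 0 <= D * t by rewrite mulr_ge0// ltW.
have WB : W * (2 * D * (c / beta) + D * (eps / 4) + D * c) <=
    2 * e ^+ 2 * t * (D * (11 / 3 * c + eps / 4)).
  apply: (@le_trans _ _ (2 * e ^+ 2 * t * (2 * D * (c / beta) + D * (eps / 4) + D * c))).
    exact: ler_wpM2r.
  by apply: ler_wpM2l => //; rewrite mulr_ge0// mulr_ge0// sqr_ge0.
have E1 : 2 * e ^+ 2 * t * (D * (11 / 3 * c + eps / 4)) =
    (22 / 3 * (e ^+ 2 * c) + e ^+ 2 * (eps / 2)) * (D * t).
  by field.
rewrite E1 ec in WB.
have h2 : e ^+ 2 * (eps / 2) <= 4^-1 * (eps / 2) by rewrite ler_wpM2r// divr_ge0// ltW.
(* The coefficient is at most [(22/21 + 1/8) eps]; [11/4] is what the target 3 leaves after the last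
   term [eps / 4]. *)
have h3 : (22 / 3 * (eps / 7) + e ^+ 2 * (eps / 2)) * (D * t) <=
    (11 / 4 * eps) * (D * t).
  rewrite ler_wpM2r//; move: h2 (eps0); move: (e ^+ 2 * _) => z; lra.
by apply: le_trans (lerD (le_trans WB h3) (lexx _)) _;
   rewrite le_eqVlt; apply/orP; left; apply/eqP; field.
Qed.

End parameters.

(** * Assembly of the final bound *)

Unset Implicit Arguments.

Theorem theorem2 (R : realType) (d : nat)
  (F : 'rV[R]_d -> R) (G sigma lam eps : R) (T : nat)
  (* probability space carrying all the randomness of the run *)
  (dO : measure_display) (Omega : measurableType dO) (P : probability Omega R)
  (* information available before drawing s_t (Gf t), and after drawing s_t (Hf t) *)
  (Gf Hf : nat -> set (set Omega))
  (* the run: x_t, Delta_t, s_t, g_t; x_0 = w_0 = x0 *)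
  (x0 : 'rV[R]_d) (x Delta g : nat -> Omega -> 'rV[R]_d) (s : nat -> Omega -> R)
  (C : R) :
  (* standing assumptions on F *)
  (forall z, differentiable F z) ->
  (forall z w, (\int[lebesgue_measure]_(t in `[0%R, 1%R]%classic)
                 (vdot (grad F (w + t *: (z - w))) (z - w))%:E = (F z - F w)%:E)%E) ->
  (forall z, vnorm (grad F z) <= G) -> 0 <= G -> 0 <= sigma ->
  (* parameters *)
  0 < lam -> 0 < eps -> eps <= 7 / 2 * (G + sigma) ->
  49 * (G + sigma) ^+ 2 / eps ^+ 2 <= T%:R ->
  (* filtration *)
  (forall t, (1 <= t <= T)%N ->
     [/\ sigma_algebra setT (Gf t), sigma_algebra setT (Hf t),
         Gf t `<=` measurable, Hf t `<=` measurable &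
         (Gf t `<=` Hf t /\ Hf t `<=` Gf t.+1)]) ->
  (* x_0 = w_0 *)
  (forall o, x 0%N o = x0) ->
  (* Delta_t (output of the learner, based on l_1..l_{t-1}) and x_t do not
     depend on s_t, g_t or later randomness *)
  (forall t, (1 <= t <= T)%N -> Gmeas_v (Gf t) (Delta t) /\ Gmeas_v (Gf t) (x t)) ->
  (* s_t ~ Unif[0,1], independent of everything before *)
  (forall t, (1 <= t <= T)%N ->
     Gmeas (Hf t) (s t) /\
     forall A B, Gf t A -> measurable B ->
       P (A `&` s t @^-1` B) = (P A * lebesgue_measure (B `&` `[0%R, 1%R]))%E) ->
  (* g_t: stochastic gradient oracle queried at y_t = x_t + s_t Delta_t *)
  (forall t, (1 <= t <= T)%N ->
     [/\ Gmeas_v (Gf t.+1) (g t),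
         (forall i, P.-integrable setT (fun o => (g t o ord0 i)%:E)),
         (forall A i, Hf t A ->
            (\int[P]_(o in A) (g t o ord0 i)%:E =
             \int[P]_(o in A) (grad F (x t o + s t o *: Delta t o) ord0 i)%:E)%E) &
         (forall A, Hf t A ->
            (\int[P]_(o in A)
               ((vnorm (g t o - grad F (x t o + s t o *: Delta t o))) ^+ 2)%:E
             <= (sigma ^+ 2)%:E * P A)%E)]) ->
  (* the learner's outputs have finite second moments (expectations are defined) *)
  (forall t, (1 <= t <= T)%N ->
     P.-integrable setT (fun o => ((vnorm (Delta t o)) ^+ 2)%:E)) ->
  (* C = C_x *)
  let Cineq (c : R) :=
    (\int[P]_o (\sum_(1 <= t < T.+1) (vnorm (x t o - x t.-1 o)) ^+ 2)%:E
     <= c%:E * \int[P]_o (\sum_(1 <= t < T.+1) (vnorm (Delta t o)) ^+ 2)%:E)%E in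
  0 <= C -> Cineq C -> (forall c, 0 <= c -> Cineq c -> C <= c) ->
  let beta := beta_star G sigma eps in
  let mu := mu_star lam G sigma eps C in
  let Ds := D_star lam G sigma eps C in
  (* regret guarantee of the online learner, for every comparator u
     (deterministic or depending on the run) *)
  (forall t, (1 <= t <= T)%N -> forall u : Omega -> 'rV[R]_d,
     (forall i, measurable_fun setT (fun o => u o ord0 i)) ->
     (\int[P]_o (regret beta mu g Delta t (u o) o)%:E
      <= \int[P]_o (2 * vnorm (u o) * (G + sigma) / (beta * Num.sqrt (1 - beta))
                    + mu / 2 * vnorm (u o) ^+ 2)%:E)%E) ->
  let w t o := x t o + Delta t o in
  let y t o := x t o + s t o *: Delta t o in
  (\sum_(1 <= t < T.+1)
      (tau_prob beta T t)%:E * \int[P]_o lam_norm F lam (ema beta y t o)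
   <= (3 * eps)%:E
      + (Ds * T%:R)^-1%:E
        * \int[P]_o (\sum_(1 <= t < T.+1) (F (x t o) - F (w t o)))%:E)%E.
Proof.
move=> dF intF bF G0 s0 lam0 eps0 epsG hT filt x0E adapted unif oracle moment.
move=> Cineq C0 HC _ beta mu Ds Hreg; cbv zeta.
have GS := Gsigma_gt0 eps0 epsG; have e0 := step_gt0 eps0 epsG.
set e := eps / (7 * (G + sigma)) in e0.
have e2 := sqr_step_le eps0 epsG; rewrite -/e in e2.
have bE : 1 - beta = e ^+ 2 := beta_starE G sigma eps.
have ee0 : 0 < e ^+ 2 by rewrite exprn_gt0.
have b0 : 0 < beta by lra.
have b1 : beta < 1 by lra.
have hT' : (1 - beta)^-1 <= T%:R by rewrite bE -(horizonE eps0 epsG).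
have T0 : (0 < T)%N.
  rewrite -(ltr0n R) (lt_le_trans _ hT')// invr_gt0 bE//.
have Tp : 0 < T%:R :> R by rewrite ltr0n.
have D0 : 0 < Ds := D_star_gt0 C lam0 eps0 epsG.
have mu0 : 0 <= mu := mu_star_ge0 C lam0 eps0 epsG.
have a0 : 0 < (G + sigma) / e by rewrite divr_gt0.
(* The noise level is enlarged from [sigma / e] to [(G + sigma) / e], which is positive even for
   [sigma = 0]. *)
have sa : sigma ^+ 2 / (1 - beta) <= ((G + sigma) / e) ^+ 2.
  rewrite bE [leRHS]expr_div_n ler_wpM2r ?invr_ge0 ?sqr_ge0//.
  by rewrite lerXn2r ?nnegrE//; lra.
have mx0 : measurable_vec (x 0%N).
  by move=> i; under eq_fun do rewrite x0E; exact: measurable_cst.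
have grad_bound := weighted_gradient_bound dF intF bF filt adapted unif oracle moment
  b0 b1 mu0 D0 a0 (ltW GS) sa Hreg.
have [_ spread_bnd] := spread_moment dF filt adapted unif oracle moment b0 b1 mx0 HC.
have lam_bnd := integral_lam_norm_le dF bF filt adapted unif oracle moment b0 b1 mx0 HC
  (ltW lam0) T0.
cbv beta in grad_bound, spread_bnd, lam_bnd.
apply: le_trans lam_bnd _.
have LF : L1 P (fun o => \sum_(1 <= t < T.+1) (F (x t o) - F (x t o + Delta t o))).
  apply: L1_sum => t; rewrite mem_index_iota ltnS => tT.
  by have [] := L1_decrease dF intF bF filt adapted unif oracle moment tT.
rewrite (ExE LF) -EFinM -EFinD lee_fin.
(* Scaling by [Ds * T] clears the denominators, so that the three bounds combine linearly. *)
rewrite -(ler_pM2l (mulr_gt0 D0 Tp)).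
set Q := Ex P (fun o => \sum_(1 <= t < T.+1) vnorm (Delta t o) ^+ 2)
  in spread_bnd grad_bound.
set I := Ex P (fun o => \sum_(1 <= t < T.+1) (F _ - F _)) in grad_bound *.
set A := \sum_(1 <= t < T.+1) weight _ _ _ * _ in grad_bound *.
set M := Ex P _ in spread_bnd *.
have -> : Ds * T%:R * (T%:R^-1 * (A + lam * M)) = Ds * A + Ds * (lam * M).
  by field; rewrite gt_eqF.
have -> : Ds * T%:R * (3 * eps + (Ds * T%:R)^-1 * I) = 3 * eps * (Ds * T%:R) + I.
  by field; rewrite !gt_eqF.
have Q0 : 0 <= Q.
  by apply: Rintegral_ge0 => o _; apply: sumr_ge0 => t _; rewrite sqr_ge0.
(* The spread is paid for by the negative term [- mu / 2 * Q] of [grad_bound]. *)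
have spr : Ds * (lam * M) <= mu / 2 * Q.
  rewrite (mu_starE C lam0 eps0 epsG) -[leRHS]mulrA ler_pM2l//.
  rewrite -[leRHS]mulrA ler_pM2l//.
  apply: le_trans spread_bnd _; rewrite ler_wpM2r//.
  exact: kappa_sqr_ge.
have err := error_terms_le C lam0 eps0 epsG (ltW Tp) (sum_weight_le b0 b1 hT').
by rewrite -/beta -/mu -/Ds -/e in err; lra.
Qed.
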